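(* Let $\Omega\subset\mathbb{R}^N$ ($N\le 3$) be a regular bounded domain, let $d\ge 2$, and let $\mathbf{a}$ be an $m$-decomposition of $d$ for some $m\le d$. Let $V_i,\beta_{ij}\in L^\infty(\Omega)$ ($i,j=1,\dots,d$) with $\beta_{ij}=\beta_{ji}$ a.e. in $\Omega$, $V_i\ge\lambda_i$ a.e. in $\Omega$ for constants $\lambda_i>-\lambda_1(\Omega)$, and $\beta_{ii}\ge\mu_i$ a.e. in $\Omega$ for constants $\mu_i>0$. Let $\mathbf{u}\in\mathcal{E}_{\mathbf{B}}\cap\mathcal{N}_{\mathbf{B}}$ be a constrained critical point of $J_{\mathbf{B}}$ restricted to $\mathcal{E}_{\mathbf{B}}\cap\mathcal{N}_{\mathbf{B}}$. Then $\mathbf{u}$ is a free critical point of $J_{\mathbf{B}}$ in $\mathbb{H}$ (that is, $dJ_{\mathbf{B}}(\mathbf{u})=0$), and $\mathbf{u}$ has at least $m$ components that are not identically zero.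
   Context: $\lambda_1(\Omega)$ is the first eigenvalue of the Dirichlet Laplacian in $\Omega$; $\mathbb{H}=(H_0^1(\Omega))^d$; $\mathbf{V}=(V_1,\dots,V_d)$, $\mathbf{B}=(\beta_{ij})_{i,j=1,\dots,d}$. An $m$-decomposition of $d$ is a vector $\mathbf{a}=(a_0,\dots,a_m)\in\mathbb{N}^{m+1}$ with $0=a_0<a_1<\dots<a_{m-1}<a_m=d$. For $h=1,\dots,m$ put $I_h=\{i: a_{h-1}<i\le a_h\}$; for $\mathbf{u}\in\mathbb{H}$ put $\mathbf{u}_h=(u_i)_{i\in I_h}$. Norms: $\|u\|_i^2=\int_\Omega(|\nabla u|^2+V_iu^2)$ and $\|\mathbf{u}_h\|_h^2=\sum_{i\in I_h}\|u_i\|_i^2$. $\mathbf{M}(\mathbf{B},\mathbf{u})$ is the symmetric $m\times m$ matrix with entries $\mathbf{M}(\mathbf{B},\mathbf{u})_{hk}=\sum_{(i,j)\in I_h\times I_k}\int_\Omega\beta_{ij}u_i^2u_j^2$. Energy: $J_{\mathbf{B}}(\mathbf{u})=\frac12\sum_{i=1}^d\|u_i\|_i^2-\frac14\int_\Omega\sum_{i,j=1}^d\beta_{ij}u_i^2u_j^2$ on $\mathbb{H}$; its critical points are the weak solutions of $-\Delta u_i+V_iu_i=\sum_j\beta_{ij}u_j^2u_i$ in $\Omega$, $u_i=0$ on $\partial\Omega$. $\mathcal{N}_{\mathbf{B}}$ is the set of $\mathbf{u}\in\mathbb{H}$ such that, for every $h=1,\dots,m$, $\|\mathbf{u}_h\|_h^2\ne0$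 and $\sum_{i\in I_h}\partial_iJ_{\mathbf{B}}(\mathbf{u})u_i=0$, i.e. $G_h(\mathbf{u}):=\|\mathbf{u}_h\|_h^2-\sum_{k=1}^m\mathbf{M}(\mathbf{B},\mathbf{u})_{hk}=0$. $\mathcal{E}_{\mathbf{B}}$ is the set of $\mathbf{u}\in\mathbb{H}$ for which $\mathbf{M}(\mathbf{B},\mathbf{u})$ is strictly diagonally dominant, i.e. $|\mathbf{M}(\mathbf{B},\mathbf{u})_{hh}|>\sum_{k\ne h}|\mathbf{M}(\mathbf{B},\mathbf{u})_{hk}|$ for every $h$. It is open in $\mathbb{H}$. A constrained critical point of $J_{\mathbf{B}}$ on $\mathcal{E}_{\mathbf{B}}\cap\mathcal{N}_{\mathbf{B}}$ is a point $\mathbf{u}$ of this set such that $dJ_{\mathbf{B}}(\mathbf{u})[\varphi]=0$ for every $\varphi\in\mathbb{H}$ with $dG_h(\mathbf{u})[\varphi]=0$ for all $h=1,\dots,m$ (the tangent space of the constraint at $\mathbf{u}$). *)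

(* Defs.v *)
From HB Require Import structures.
From mathcomp Require Import all_boot all_order all_algebra.
From mathcomp Require Import all_classical all_reals all_analysis.
Set Implicit Arguments.
Unset Strict Implicit.
Unset Printing Implicit Defensive.
Import Order.TTheory GRing.Theory Num.Theory.
Import numFieldNormedType.Exports.
Local Open Scope classical_set_scope.
Local Open Scope ring_scope.

Definition measure_rV_display : measure_display. Proof. exact. Qed.

(* 'rV[R]_n carries the sigma-algebra generated by its coordinates (which is
   the Borel one), as n.-tuple R does in the library. *)
Section measurable_rV.
Context {R : realType} (n : nat).

Let coords : 'I_n -> 'rV[R]_n -> R := fun i x => x ord0 i.

Let rV_set0 : g_sigma_preimage coords set0.
Proof. exact: sigma_algebra0. Qed.

Let rV_setC A : g_sigma_preimage coords A -> g_sigma_preimage coords (~` A).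
Proof. exact: sigma_algebraC. Qed.

Let rV_bigcup (F : (set 'rV[R]_n)^nat) :
  (forall i, g_sigma_preimage coords (F i)) ->
  g_sigma_preimage coords (\bigcup_i (F i)).
Proof. exact: sigma_algebra_bigcup. Qed.

HB.instance Definition _ := @isMeasurable.Build measure_rV_display
  'rV[R]_n (g_sigma_preimage coords) rV_set0 rV_setC rV_bigcup.
End measurable_rV.

Lemma measurable_fun_rVP d (T : measurableType d) (R : realType) n
    (f : T -> 'rV[R]_n) :
  measurable_fun [set: T] f <->
  forall i, measurable_fun [set: T] (fun x => f x ord0 i).
Proof.
apply: (@iff_trans _ (g_sigma_preimage
    (fun i x => f x ord0 i) `<=` measurable)).
  rewrite [X in X `<=` _](g_sigma_preimage_comp
    (fun i (x : 'rV[R]_n) => x ord0 i) f).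
  split=> [mf A [/= C preC <-]|prefS]; first exact: mf.
  by move=> _ A mA; apply: prefS; exists A.
split=> [fS i|mf].
- move=> _ A mA; apply: fS; apply: sub_sigma_algebra.
  case: n i f => [[] []//|n i] f.
  rewrite -bigcup_mkord_ord.
  exists i; first exact: ltn_ord.
  by exists A => //; rewrite inord_val.
- apply: smallest_sub; first exact: sigma_algebra_measurable.
  case: n f mf => [|n] f mf; first by rewrite big_ord0.
  rewrite -bigcup_mkord_ord; apply: bigcup_sub => i Ii.
  by move=> A [B mB <-]; exact: mf.
Qed.


Lemma measurable_coord (R : realType) n (i : 'I_n) :
  measurable_fun setT (fun x : 'rV[R]_n => x ord0 i).
Proof. by apply: (measurable_fun_rVP id).1. Qed.

Definition rVcons (R : realType) n (p : R * 'rV[R]_n) : 'rV[R]_n.+1 :=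
  row_mx (p.1%:M : 'rV[R]_1) p.2.

Lemma rVcons0 (R : realType) n (p : R * 'rV[R]_n) : rVcons p ord0 ord0 = p.1.
Proof.
rewrite /rVcons [LHS](_ : _ = row_mx p.1%:M p.2 ord0 (lshift n ord0)).
  by rewrite row_mxEl mxE eqxx mulr1n.
by congr (fun_of_matrix _ _ _); apply: val_inj.
Qed.

Lemma rVconsS (R : realType) n (p : R * 'rV[R]_n) (j : 'I_n) :
  rVcons p ord0 (lift ord0 j) = p.2 ord0 j.
Proof.
rewrite /rVcons [LHS](_ : _ = row_mx p.1%:M p.2 ord0 (rshift 1 j)).
  by rewrite row_mxEr.
by congr (fun_of_matrix _ _ _); apply: val_inj.
Qed.

Lemma measurable_rVcons (R : realType) n : measurable_fun setT (@rVcons R n).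
Proof.
apply/measurable_fun_rVP => i; case: (unliftP ord0 i) => [j ->|->].
  under eq_fun do rewrite rVconsS.
  exact: (measurableT_comp (measurable_coord j) measurable_snd).
by under eq_fun do rewrite rVcons0; exact: measurable_fst.
Qed.

Lemma sigma_finite_prod d1 d2 (T1 : measurableType d1)
    (T2 : measurableType d2) (R : realType)
    (m1 : {sigma_finite_measure set T1 -> \bar R})
    (m2 : {sigma_finite_measure set T2 -> \bar R}) :
  sigma_finite setT (m1 \x m2)%E.
Proof.
have /sigma_finiteP[F [TF ndF Foo]] := sigma_finiteT m1.
have /sigma_finiteP[G [TG ndG Goo]] := sigma_finiteT m2.
exists (fun n => F n `*` G n).
  rewrite -setXTT TF TG predeqE => -[x y]; split.
    move=> [/= [n _ Fnx] [k _ Gky]]; exists (maxn n k) => //; split.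
    - by move: x Fnx; exact/subsetPset/ndF/leq_maxl.
    - by move: y Gky; exact/subsetPset/ndG/leq_maxr.
  by move=> [n _ []/= ? ?]; split; exists n.
move=> k; have [? ?] := Foo k; have [? ?] := Goo k.
split; first exact: measurableX.
by rewrite product_measure1E// lte_mul_pinfty// ge0_fin_numE.
Qed.

Section lebesgue_rVS.
Context {R : realType} n (mu : {sigma_finite_measure set 'rV[R]_n -> \bar R}).
Local Open Scope ereal_scope.

Definition lebesgue_rVS : set 'rV[R]_n.+1 -> \bar R :=
  pushforward (lebesgue_measure \x mu) (@rVcons R n).

Let lebesgue_rVS0 : lebesgue_rVS set0 = 0.
Proof. by rewrite /lebesgue_rVS /pushforward preimage_set0 measure0. Qed.

Let lebesgue_rVS_ge0 A : 0 <= lebesgue_rVS A.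
Proof. by rewrite /lebesgue_rVS /pushforward; exact: measure_ge0. Qed.

Let lebesgue_rVS_sigma_additive : semi_sigma_additive lebesgue_rVS.
Proof.
pose pf := measure_function_pushforward__canonical__measure_function_Measure
  (lebesgue_measure \x mu) (@measurable_rVcons R n).
exact: (@measure_semi_sigma_additive _ _ _ pf).
Qed.

HB.instance Definition _ := isMeasure.Build _ _ _ lebesgue_rVS
  lebesgue_rVS0 lebesgue_rVS_ge0 lebesgue_rVS_sigma_additive.

Let lebesgue_rVS_sigma_finite : sigma_finite setT lebesgue_rVS.
Proof.
have [F FT mF] : sigma_finite setT (lebesgue_measure \x mu).
  exact: sigma_finite_prod.
pose g (v : 'rV[R]_n.+1) : R * 'rV[R]_n :=
  (v ord0 ord0, \row_j v ord0 (lift ord0 j)).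
have gK : cancel (@rVcons R n) g.
  move=> [x v]; congr (_, _); first exact: rVcons0.
  by apply/rowP => j; rewrite mxE rVconsS.
have mg : measurable_fun setT g.
  apply/measurable_fun_pairP; split; first exact: measurable_coord.
  apply/measurable_fun_rVP => j; under eq_fun do rewrite /= mxE.
  exact: measurable_coord.
exists (fun k => g @^-1` F k); first by rewrite -preimage_bigcup -FT.
move=> k; have [mFk Fkoo] := mF k; split.
  by rewrite -[X in measurable X]setTI; exact: mg.
rewrite /lebesgue_rVS /pushforward -comp_preimage.
by rewrite (_ : _ \o _ = id)//; apply/funext.
Qed.

HB.instance Definition _ := Measure_isSigmaFinite.Build _ _ _ lebesgue_rVS
  lebesgue_rVS_sigma_finite.

End lebesgue_rVS.

(* n-dimensional Lebesgue measure: the product of n copies of the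
   one-dimensional one; lebesgue_rV_box gives its value on boxes. *)
Fixpoint lebesgue_rV (R : realType) n :
    {sigma_finite_measure set 'rV[R]_n -> \bar R} :=
  match n with
  | 0 => dirac (0 : 'rV[R]_0)
  | n'.+1 => lebesgue_rVS (lebesgue_rV R n')
  end.

Lemma lebesgue_rV_box (R : realType) n (a b : 'I_n -> R) :
  (forall i, a i <= b i) ->
  lebesgue_rV R n [set x | forall i, a i <= x ord0 i <= b i] =
  (\prod_(i < n) (b i - a i))%:E.
Proof.
elim: n a b => [|n IHn] a b ab.
  rewrite big_ord0 /= [X in dirac _ X](_ : _ = setT) ?diracT//.
  by apply/seteqP; split => // x _ [].
have mbox : measurable [set x : 'rV[R]_n |
    forall i, a (lift ord0 i) <= x ord0 i <= b (lift ord0 i)].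
  rewrite [X in measurable X](_ : _ = \bigcap_(i in [set: 'I_n])
      (fun x : 'rV[R]_n => x ord0 i) @^-1` `[a (lift ord0 i), b (lift ord0 i)]).
    apply: fin_bigcap_measurable => // i _.
    by rewrite -[X in measurable X]setTI; apply: measurable_coord.
  apply/seteqP; split => x /= xab i; first by move=> _ /=; rewrite in_itv/= xab.
  by have := xab i I; rewrite /= in_itv.
rewrite /= /lebesgue_rVS /pushforward big_ord_recl EFinM -IHn//.
rewrite (_ : _ @^-1` _ = `[a ord0, b ord0] `*` [set x : 'rV[R]_n |
    forall i, a (lift ord0 i) <= x ord0 i <= b (lift ord0 i)]).
  rewrite product_measure1E//; congr (_ * _)%E.
  apply: (etrans (lebesgue_measure_itv `[a ord0, b ord0])).
  by rewrite /= lte_fin; case: ltgtP (ab ord0) => // ->; rewrite subrr.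
apply/seteqP; split => -[x v] /=.
  move=> xv; split => [|i]; first by have := xv ord0; rewrite rVcons0 in_itv.
  by have := xv (lift ord0 i); rewrite rVconsS.
move=> [/= x0 xv] i; case: (unliftP ord0 i) => [j ->|->].
  by rewrite rVconsS xv.
by rewrite rVcons0/=; rewrite in_itv/= in x0.
Qed.

Section domains.
Context {R : realType} {N : nat}.
Implicit Types Omega : set 'rV[R]_N.

(* Local graph description without a choice of rotated coordinates: gamma is
   constant along nu, hence a Lipschitz function on the hyperplane orthogonal
   to nu, and near the boundary point Omega is the set below its graph in
   the direction nu. *)
Definition lipschitz_boundary Omega : Prop :=
  forall x, (closure Omega `\` interior Omega) x ->
  exists (nu : 'rV[R]_N) (gamma : 'rV[R]_N -> R),
    [/\ nu != 0,
        [lipschitz gamma y | y in setT],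
        forall y s, gamma (y + s *: nu) = gamma y &
        \forall y \near x,
          Omega y <-> \sum_(k < N) y ord0 k * nu ord0 k < gamma y].

(* "Regular" is read as having a Lipschitz boundary, the weakest of its usual
   meanings: C^1 and smoother boundaries are covered. *)
Definition regular_bounded_domain Omega : Prop :=
  [/\ open Omega, connected Omega, Omega !=set0, bounded_set Omega &
      lipschitz_boundary Omega].

End domains.

Section sobolev.
Context {R : realType} {N : nat} (Omega : set 'rV[R]_N).
Local Notation E := 'rV[R]_N.
Local Notation leb := (lebesgue_rV R N).
Implicit Types (u v w phi psi : E -> R) (g : 'I_N -> E -> R).

Definition ae_in (P : E -> Prop) : Prop :=
  {ae leb, forall x, Omega x -> P x}.

(* Functions on Omega are represented by functions on the whole space, of
   which only the values on Omega matter, and that up to a null set. *)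
Definition Lp (p : \bar R) u : Prop := u \_ Omega \in Lfun leb p.

Definition cvg_L2 (phi_ : nat -> E -> R) u : Prop :=
  ('N[leb]_(2%:E)[EFin \o ((fun x => (phi_ n x - u x)%R) \_ Omega)])%E
    @[n --> \oo] --> 0%E.

Definition partial (k : 'I_N) u : E -> R := 'D_(delta_mx ord0 k) u.

Definition smooth u : Prop :=
  forall s : seq 'I_N, let du := foldr partial u s in
  continuous du /\ forall x k, derivable du x (delta_mx ord0 k).

Definition test_function phi : Prop :=
  [/\ smooth phi, compact (closure [set x | phi x != 0]) &
      closure [set x | phi x != 0] `<=` Omega].

Definition weak_gradient u g : Prop :=
  forall k psi, test_function psi ->
  \int[leb]_(x in Omega) (u x * partial k psi x) =
  - \int[leb]_(x in Omega) (g k x * psi x).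

(* u belongs to the closure of the test functions in H^1(Omega), and g is its
   weak gradient. *)
Definition H01_gradient u g : Prop :=
  [/\ Lp 2%:E u, forall k, Lp 2%:E (g k), weak_gradient u g &
      exists phi_ : nat -> E -> R,
        [/\ forall n, test_function (phi_ n), cvg_L2 phi_ u &
            forall k, cvg_L2 (fun n => partial k (phi_ n)) (g k)]].

Definition H01 u : Prop := exists g, H01_gradient u g.

(* a representative of the gradient of an element of H01 *)
Definition grad u : 'I_N -> E -> R := get (H01_gradient u).

Definition dirichlet_eigenvalue (l : R) : Prop :=
  exists w, [/\ H01 w, ~ ae_in (fun x => w x = 0) &
    forall v, H01 v ->
      \int[leb]_(x in Omega) (\sum_(k < N) grad w k x * grad v k x) =
      l * \int[leb]_(x in Omega) (w x * v x)].

Definition lambda1 : R := inf [set l | dirichlet_eigenvalue l].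

(* the square of the norm with potential Vi *)
Definition normsq (Vi : E -> R) u : R :=
  \int[leb]_(x in Omega) ((\sum_(k < N) grad u k x ^+ 2) + Vi x * u x ^+ 2).

End sobolev.

Definition is_decomposition (d m : nat) (a : m.+1.-tuple nat) : bool :=
  [&& nth 0 a 0 == 0, nth 0 a m == d & sorted ltn a]%N.

(* Components and blocks are numbered from 0: the index i : 'I_d is the
   (i+1)-st component, h : 'I_m the (h+1)-st block. *)
Definition block (d m : nat) (a : m.+1.-tuple nat) (h : 'I_m) : pred 'I_d :=
  [pred i : 'I_d | nth 0 a h <= i < nth 0 a h.+1]%N.

Section energy.
Context {R : realType} {N d m : nat} (Omega : set 'rV[R]_N).
Local Notation E := 'rV[R]_N.
Local Notation leb := (lebesgue_rV R N).
Context (a : m.+1.-tuple nat) (V : 'I_d -> E -> R) (B : 'I_d -> 'I_d -> E -> R).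
Implicit Types u phi : 'I_d -> E -> R.

Definition HH u : Prop := forall i, H01 Omega (u i).

Definition block_normsq (h : 'I_m) u : R :=
  \sum_(i | block a h i) normsq Omega (V i) (u i).

Definition MB u : 'M[R]_m :=
  \matrix_(h < m, k < m) \sum_(i | block a h i) \sum_(j | block a k j)
    \int[leb]_(x in Omega) (B i j x * u i x ^+ 2 * u j x ^+ 2).

Definition JB u : R :=
  2^-1 * (\sum_(i < d) normsq Omega (V i) (u i)) -
  4^-1 * \int[leb]_(x in Omega)
    (\sum_(i < d) \sum_(j < d) B i j x * u i x ^+ 2 * u j x ^+ 2).

Definition GB (h : 'I_m) u : R := block_normsq h u - \sum_(k < m) MB u h k.

Definition nehari u : Prop :=
  HH u /\ forall h, block_normsq h u != 0 /\ GB h u = 0.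

Definition strictly_diagonally_dominant (M : 'M[R]_m) : Prop :=
  forall h, \sum_(k < m | k != h) `|M h k| < `|M h h|.

Definition EB u : Prop := HH u /\ strictly_diagonally_dominant (MB u).

(* dF(u)[phi] = l, as a directional derivative; is_derive includes its
   existence. *)
Definition has_differential (F : ('I_d -> E -> R) -> R) u phi (l : R) : Prop :=
  is_derive (0 : R) (1 : R) (fun t : R => F (fun i x => u i x + t * phi i x)) l.

Definition constrained_critical_point u : Prop :=
  [/\ EB u, nehari u &
      forall phi, HH phi ->
        (forall h, has_differential (GB h) u phi 0) ->
        has_differential JB u phi 0].

Definition free_critical_point u : Prop :=
  HH u /\ forall phi, HH phi -> has_differential JB u phi 0.

End energy.

(* Main.v *)
(* The vectors (0, .., u_h, .., 0) span a complement of the tangent space of the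
   Nehari constraint: the matrix of the differentials of the constraints G_h along
   them is - 2 M(B, u), which is invertible by diagonal dominance. As dJ vanishes
   along them on the constraint, dJ(u) = 0 on the tangent space forces dJ(u) = 0.

   That J and G_h are polynomial along lines rests on the embedding of H01 into
   L^4 for N <= 3. For test functions it is proved by induction on N, slicing in
   the first coordinate z and using, for every e > 0,
     int |v(z, .)|^2 <= e int |d_z v|^2 + e^-1 int v^2.
   The gradient of an element of H01 is unique because partial derivatives of
   test functions are again test functions: a difference of two weak gradients is
   orthogonal to all test functions and is an L^2 limit of such functions. *)
Require Import Defs.
From mathcomp Require Import all_boot all_order all_algebra.
From mathcomp Require Import all_classical all_reals all_analysis.
From mathcomp Require Import measurable_realfun ess_sup_inf ring lra.
Set Implicit Arguments.
Unset Strict Implicit.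
Unset Printing Implicit Defensive.
Import Order.TTheory GRing.Theory Num.Theory.
Import numFieldNormedType.Exports.
Local Open Scope classical_set_scope.
Local Open Scope ring_scope.

(** * Borel sets and Tonelli on R^n *)

(** By symmetry of [B], dJ(u)[(0, .., u_h, .., 0)] = G_h(u). As for the matrix, along the k-th of
    these vectors the squared norm of u_h varies at rate 2 delta_hk |u_h|^2 and the sum of the M_hl
    over l at rate 2 delta_hk sum_l M_hl + 2 M_hk; G_h(u) = 0 cancels the two diagonal terms and
    leaves - 2 M_hk.

    The parameter e serves the passage to dimension 3. On a slice, the gradient energy is only
    integrable in z, while the L^2 norm is bounded uniformly in z. So the planar estimate may
    contain that energy to the first power only, with the L^2 norm as the other factor; the optimal
    e brings it to this form.

    For the number of nonzero components: every block has nonzero norm, a component that vanishes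
    a.e. has zero norm because uniqueness makes its gradient vanish as well, and blocks are
    disjoint. *)

Lemma open_measurable_rV (R : realType) n (U : set 'rV[R]_n) :
  open U -> measurable U.
Proof.
move=> oU.
pose box (p : 'rV[rat]_n * rat) : set 'rV[R]_n :=
  \bigcap_(i in [set: 'I_n]) (fun x : 'rV[R]_n => x ord0 i) @^-1`
    `]ratr (p.1 ord0 i) - ratr p.2, ratr (p.1 ord0 i) + ratr p.2[.
have mbox p : measurable (box p).
  apply: fin_bigcap_measurable => // i _.
  by rewrite -[X in measurable X]setTI; apply: measurable_coord.
(* The boxes with rational centre and half-width that lie in [U] cover it, and their index type is
   countable. *)
rewrite (_ : U = \bigcup_(p in [set p | box p `<=` U]) box p).
  rewrite bigcup_mkcond; apply: countable_bigcupT_measurable => [//|p].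
  by case: ifPn.
apply/seteqP; split => [x Ux|x [p pU]]; last exact: pU.
have [e /= e0 xeU] : nbhs_ball x U by apply/nbhs_ballP; move: oU; rewrite openE; exact.
(* A box of half-width [r] that contains [x] stays within 2 r < e of [x]. *)
have [r] : exists r : rat, ratr r \in `](0 : R), (e / 2)[.
  by apply: rat_in_itvoo; rewrite divr_gt0.
rewrite in_itv/= => /andP[r0 re].
have /choice[q qP] : forall i, exists q : rat,
    x ord0 i - ratr r < ratr q < x ord0 i + ratr r.
  move=> i; have [|q] := @rat_in_itvoo R (x ord0 i - ratr r) (x ord0 i + ratr r).
    by rewrite ltrBlDr -addrA ltrDl addr_gt0.
  by rewrite in_itv/= => ?; exists q.
exists (\row_i q i, r) => /=; last first.
  move=> i _ /=; rewrite in_itv/= mxE; have := qP i; lra.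
move=> y yb; apply: xeU; split=> // i j; rewrite ord1.
have := yb j I; rewrite /= in_itv/= mxE; have := qP j.
by rewrite /ball/= => h1 h2; rewrite ltr_distlC; lra.
Qed.

Lemma continuous_measurable_rV (R : realType) n (f : 'rV[R]_n -> R) :
  continuous f -> measurable_fun setT f.
Proof.
move=> /continuousP cf; apply: (measurability _ (RGenOpens.measurableE R)).
move=> _ [_ [a [b ->] <-]]; rewrite setTI; apply: open_measurable_rV.
exact/cf/interval_open.
Qed.

Section rV_tonelli.
Context {R : realType} (n : nat).
Local Open Scope ereal_scope.

Lemma ge0_integral_rVS (f : 'rV[R]_n.+1 -> \bar R) :
  measurable_fun setT f -> (forall x, 0 <= f x) ->
  \int[lebesgue_rV R n.+1]_x f x =
  \int[lebesgue_measure]_z \int[lebesgue_rV R n]_y f (rVcons (z, y)).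
Proof.
move=> mf f0.
have mc := @measurable_rVcons R n.
(* The set function is the same; only its structure is replaced, by the canonical push-forward for
   which the change of variables is stated. *)
rewrite (@eq_measure_integral _ _ R setT
  (measure_function_pushforward__canonical__measure_function_Measure
    (lebesgue_measure \x lebesgue_rV R n) mc) (lebesgue_rV R n.+1) f)//.
rewrite ge0_integral_pushforward//.
rewrite preimage_setT.
have mfc : measurable_fun setT (f \o @rVcons R n) by exact: measurableT_comp.
have fc0 x : 0 <= (f \o @rVcons R n) x by exact: f0.
exact: (fubini_tonelli1 (m1:=lebesgue_measure) (m2:=lebesgue_rV R n) _ mfc).
Qed.

Lemma ge0_integral_rVS2 (f : 'rV[R]_n.+1 -> \bar R) :
  measurable_fun setT f -> (forall x, 0 <= f x) ->
  \int[lebesgue_rV R n.+1]_x f x =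
  \int[lebesgue_rV R n]_y \int[lebesgue_measure]_z f (rVcons (z, y)).
Proof.
move=> mf f0; rewrite ge0_integral_rVS//.
have mfc : measurable_fun setT (f \o @rVcons R n).
  by apply: measurableT_comp => //; exact: measurable_rVcons.
have fc0 x : 0 <= (f \o @rVcons R n) x by exact: f0.
exact: (fubini_tonelli (m1:=lebesgue_measure) (m2:=lebesgue_rV R n) _ mfc).
Qed.

Lemma measurable_fun_slice_integral (f : 'rV[R]_n.+1 -> \bar R) :
  measurable_fun setT f -> (forall x, 0 <= f x) ->
  measurable_fun setT (fun z => \int[lebesgue_rV R n]_y f (rVcons (z, y))).
Proof.
move=> mf f0.
have mfc : measurable_fun setT (f \o @rVcons R n).
  by apply: measurableT_comp => //; exact: measurable_rVcons.
have fc0 x : 0 <= (f \o @rVcons R n) x by exact: f0.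
exact: (measurable_fun_fubini_tonelli_F (m2:=lebesgue_rV R n) _ mfc).
Qed.

Lemma measurable_fun_slice_integral2 (f : 'rV[R]_n.+1 -> \bar R) :
  measurable_fun setT f -> (forall x, 0 <= f x) ->
  measurable_fun setT (fun y => \int[lebesgue_measure]_z f (rVcons (z, y))).
Proof.
move=> mf f0.
have mfc : measurable_fun setT (f \o @rVcons R n).
  by apply: measurableT_comp => //; exact: measurable_rVcons.
have fc0 x : 0 <= (f \o @rVcons R n) x by exact: f0.
exact: (measurable_fun_fubini_tonelli_G (m1:=lebesgue_measure) _ mfc).
Qed.

End rV_tonelli.

(** * Slices along the first coordinate and their derivatives *)

Section slices.
Context {R : realType} {n : nat}.
Implicit Types (y w : 'rV[R]_n) (z : R) (f : 'rV[R]_n.+1 -> R).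

Lemma rVcons_ball z z' y y' (e : R) : ball z e z' -> ball y e y' ->
  ball (rVcons (z, y)) e (rVcons (z', y')).
Proof.
move=> zz' [e0 yy']; split => // i j; rewrite ord1.
by case: (unliftP ord0 j) => [k ->|->]; rewrite ?rVconsS ?rVcons0.
Qed.

Lemma continuous_rVcons_r z : continuous (fun y => rVcons (z, y)).
Proof.
move=> y A /nbhs_ballP[e /= e0 eA]; apply/nbhs_ballP; exists e => // y' yy'.
by apply: eA; apply: rVcons_ball => //; exact: ballxx.
Qed.

Lemma continuous_rVcons_l y : continuous (fun z : R => rVcons (z, y)).
Proof.
move=> z A /nbhs_ballP[e /= e0 eA]; apply/nbhs_ballP; exists e => // z' zz'.
by apply: eA; apply: rVcons_ball => //; exact: ballxx.
Qed.

(** The increment is written on the left, as in the difference quotient behind [derive]: the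
    quotients of a slice and of the function then coincide, so derivability and derivatives transfer
    with no limit argument. *)
Lemma rVcons_shift_r z y (h : R) (k : 'I_n) :
  rVcons (z, h *: delta_mx ord0 k + y) =
  h *: delta_mx ord0 (lift ord0 k) + rVcons (z, y).
Proof.
apply/rowP => i; case: (unliftP ord0 i) => [j ->|->].
  by rewrite rVconsS [RHS]mxE rVconsS !mxE/= (inj_eq lift_inj).
by rewrite rVcons0 [RHS]mxE rVcons0 !mxE/= mulr0 add0r.
Qed.

Lemma rVcons_shift_l z y (h : R) :
  rVcons (h *: (1 : R) + z, y) = h *: delta_mx ord0 ord0 + rVcons (z, y).
Proof.
apply/rowP => i; case: (unliftP ord0 i) => [j ->|->].
  by rewrite rVconsS [RHS]mxE rVconsS !mxE/= mulr0 add0r.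
by rewrite rVcons0 [RHS]mxE rVcons0 !mxE/=.
Qed.

Lemma derivable_slice_r f z y (k : 'I_n) :
  derivable f (rVcons (z, y)) (delta_mx ord0 (lift ord0 k)) ->
  derivable (fun y => f (rVcons (z, y))) y (delta_mx ord0 k).
Proof. by rewrite /derivable; under eq_fun do rewrite /= -rVcons_shift_r. Qed.

Lemma partial_slice_r f z y (k : 'I_n) :
  partial k (fun y => f (rVcons (z, y))) y =
  partial (lift ord0 k) f (rVcons (z, y)).
Proof.
by rewrite /partial /derive; under eq_fun do rewrite /= rVcons_shift_r.
Qed.

Lemma derivable_slice_l f z y :
  derivable f (rVcons (z, y)) (delta_mx ord0 ord0) ->
  derivable (fun z => f (rVcons (z, y))) z 1.
Proof. by rewrite /derivable; under eq_fun do rewrite /= -rVcons_shift_l. Qed.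

Lemma partial_slice_l f z y :
  derive1 (fun z => f (rVcons (z, y))) z = partial ord0 f (rVcons (z, y)).
Proof.
by rewrite derive1E /partial /derive; under eq_fun do rewrite /= rVcons_shift_l.
Qed.

End slices.

(** * A pointwise bound in one variable *)

Section one_dim.
Context {R : realType}.
Local Notation mu := (@lebesgue_measure R).

(** As g(- M) = 0, the fundamental theorem of calculus writes g(z)^2 as the integral of 2 g g' over
    [- M, z]; Young's inequality with weight [e] bounds the integrand, and the domain is then
    enlarged to the line. *)
Lemma sqr_le_integral_derive (g : R -> R) (M e : R) : 0 < e ->
  (forall z, derivable g z 1) -> continuous (derive1 g) ->
  (forall z, M <= `|z| -> g z = 0) ->
  forall z, ((g z ^+ 2)%:E <=
    \int[mu]_s (e * derive1 g s ^+ 2 + e^-1 * g s ^+ 2)%:E)%E.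
Proof.
move=> e0 dg cg' gM z.
have cg : continuous g.
  by move=> s; apply: differentiable_continuous; exact/derivable1_diffP.
pose K s := e * derive1 g s ^+ 2 + e^-1 * g s ^+ 2.
have K0 s : 0 <= K s.
  by rewrite addr_ge0// mulr_ge0 ?sqr_ge0 ?invr_ge0// ltW.
have cK : continuous K.
  move=> s; apply: cvgD; apply: cvgM; try exact: cvg_cst.
    by apply: cvgM; exact: cg'.
  by apply: cvgM; exact: cg.
have mK : measurable_fun setT K by exact: continuous_measurable_fun.
have [Mz|zM] := leP M `|z|.
  by rewrite gM// expr0n/= integral_ge0// => s _; rewrite lee_fin; exact: K0.
have Mz : - M < z by move: zM; rewrite ltr_norml => /andP[].
have M0 : 0 < M by exact: le_lt_trans zM.
pose f s := 2 * g s * derive1 g s.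
have cf : continuous f.
  move=> s; apply: cvgM; last exact: cg'.
  by apply: cvgM; [exact: cvg_cst|exact: cg].
have dF (s : R) : is_derive s (1 : R) (fun s => g s ^+ 2) (f s).
  have Dg : is_derive s (1 : R) g (derive1 g s) by rewrite derive1E; exact: derivableP.
  apply: is_derive_eq; rewrite /f /GRing.scale/=; ring.
have FTC : (\int[mu]_(x in `[(- M)%R, z]) (f x)%:E =
    (g z ^+ 2)%:E - (g (- M)%R ^+ 2)%:E)%E.
  apply: (@continuous_FTC2 _ f (fun s => g s ^+ 2)) => //.
  - exact: continuous_subspaceT.
  - split.
    + by move=> s _; apply: ex_derive; exact: dF.
    + apply: cvg_at_right_filter; apply: cvgM; exact: cg.
    + apply: cvg_at_left_filter; apply: cvgM; exact: cg.
  - by move=> s _; rewrite derive1E; apply: derive_val; exact: dF.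
have gM0 : g (- M) = 0 by apply: gM; rewrite normrN ger0_norm// ltW.
move: FTC; rewrite gM0 expr0n/= sube0 => <-.
have mf : measurable_fun setT f by exact: continuous_measurable_fun.
apply: (@le_trans _ _ (\int[mu]_(x in `[(- M)%R, z]) (K x)%:E)%E).
  apply: (@le_trans _ _ (\int[mu]_(x in `[(- M)%R, z]) `|(f x)%:E|)%E).
    apply: le_trans (lee_abs _) _; apply: le_abse_integral => //.
    by apply/measurable_EFinP; exact: measurable_funTS.
  apply: ge0_le_integral => //.
  - by apply: measurableT_comp => //; apply/measurable_EFinP; exact: measurable_funTS.
  - by apply/measurable_EFinP; exact: measurable_funTS.
  - move=> s _; rewrite abse_EFin lee_fin /f /K.
    have ee : e * e^-1 = 1 by rewrite divff// gt_eqF.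
    have ei : 0 < e^-1 by rewrite invr_gt0.
    rewrite ler_norml; set a := g s; set b := derive1 g s; set i := e^-1 in ee ei *.
    (* Young's inequality |2 a b| <= e b^2 + a^2 / e, read off from the two squares (a + e b)^2 / e
       and (a - e b)^2 / e. *)
    have h1 := mulr_ge0 (ltW ei) (sqr_ge0 (a + e * b)).
    have h2 := mulr_ge0 (ltW ei) (sqr_ge0 (a - e * b)).
    have E1 : i * (a + e * b) ^+ 2 = e * b ^+ 2 + i * a ^+ 2 + 2 * a * b.
      transitivity (e * b ^+ 2 * (e * i) + i * a ^+ 2 + 2 * a * b * (e * i)); first ring.
      by rewrite ee !mulr1.
    have E2 : i * (a - e * b) ^+ 2 = e * b ^+ 2 + i * a ^+ 2 - 2 * a * b.
      transitivity (e * b ^+ 2 * (e * i) + i * a ^+ 2 - 2 * a * b * (e * i)); first ring.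
      by rewrite ee !mulr1.
    by apply/andP; split; lra.
apply: ge0_subset_integral => //; first exact/measurable_EFinP.
by move=> s _; rewrite lee_fin; exact: K0.
Qed.

End one_dim.

(** * Ladyzhenskaya's inequality *)

Lemma expr4_ge0 (R : realDomainType) (x : R) : 0 <= x ^+ 4.
Proof. by rewrite (_ : x ^+ 4 = (x ^+ 2) ^+ 2) ?sqr_ge0// -exprM. Qed.

Section compactly_supported.
Context {R : realType}.
Local Notation leb := (lebesgue_rV R).

(** [f] is bounded on the cube [- M, M]^n, which is compact and of finite measure, and vanishes
    outside it. For n = 0 the cube is the whole one-point space. *)
Lemma integral_sqr_lty n (f : 'rV[R]_n -> R) (M : R) : continuous f ->
  (forall (x : 'rV[R]_n) i, M <= `|x ord0 i| -> f x = 0) ->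
  (\int[leb n]_x (f x ^+ 2)%:E < +oo)%E.
Proof.
move=> cf fM; wlog M0 : M fM / 0 <= M.
  move=> /(_ `|M|); apply => // x i /(le_trans (ler_norm _)); exact: fM.
pose box := [set x : 'rV[R]_n | forall i, - M <= x ord0 i <= M].
have cbox : compact box.
  rewrite (_ : box = [set v | forall i, `[- M, M]%classic (v ord0 i)]).
    by apply: (@rV_compact _ _ (fun=> `[- M, M]%classic)) => i; exact: segment_compact.
  by apply/seteqP; split=> x xb i /=; have := xb i; rewrite /= in_itv.
have [C [_ fC]] := compact_bounded (continuous_compact (continuous_subspaceT cf) cbox).
have {}fC x : box x -> `|f x| <= C + 1.
  by move=> bx; apply: fC; [rewrite ltrDl|exists x].
have mbox : measurable box.
  rewrite (_ : box = \bigcap_(i in [set: 'I_n])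
      (fun x : 'rV[R]_n => x ord0 i) @^-1` `[- M, M]).
    apply: fin_bigcap_measurable => // i _.
    by rewrite -[X in measurable X]setTI; apply: measurable_coord.
  apply/seteqP; split => x /= xab i; first by move=> _ /=; rewrite in_itv/= xab.
  by have := xab i I; rewrite /= in_itv.
have mf : measurable_fun setT (fun x => (f x ^+ 2)%:E).
  by apply/measurable_EFinP; apply: measurable_funX; exact: continuous_measurable_rV.
apply: (@le_lt_trans _ _ (\int[leb n]_(x in box) ((C + 1) ^+ 2)%:E)%E).
  rewrite [leRHS]integral_mkcond; apply: ge0_le_integral => //.
  - by move=> x _; rewrite lee_fin sqr_ge0.
  - apply/(measurable_restrictT _ _).1 => //.
  - move=> x _; rewrite patchE; case: ifPn => [/set_mem bx|].
      rewrite lee_fin -[leLHS]ger0_norm ?sqr_ge0// normrX lerXn2r ?nnegrE//; last exact: fC.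
      by apply: le_trans (fC _ bx).
    rewrite notin_setE => /existsNP[i xi].
    have -> : f x = 0.
      apply: (fM x i); rewrite leNgt; apply/negP; rewrite ltr_norml => /andP[h1 h2].
      by apply: xi; rewrite !ltW.
    by rewrite expr0n.
have boxoo : (leb n box < +oo)%E.
  by rewrite (@lebesgue_rV_box R n (fun=> - M) (fun=> M)) ?ltry// => _; lra.
rewrite integral_cst//; apply: lte_mul_pinfty => //.
by rewrite lee_fin sqr_ge0.
Qed.

(** The class on which the induction on the dimension runs. Compact support is expressed by a cube,
    so that a slice inherits the same [M]. *)
Definition C1c n (v : 'rV[R]_n -> R) := [/\ continuous v,
  forall k x, derivable v x (delta_mx ord0 k),
  forall k, continuous (partial k v) &
  exists M, forall (x : 'rV[R]_n) i, M <= `|x ord0 i| ->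
    v x = 0 /\ forall k, partial k v x = 0].

Definition L2sq n (v : 'rV[R]_n -> R) := (\int[leb n]_x (v x ^+ 2)%:E)%E.

Lemma L2sq_ge0 n (v : 'rV[R]_n -> R) : (0 <= L2sq v)%E.
Proof. by apply: integral_ge0 => x _; rewrite lee_fin sqr_ge0. Qed.

Definition slice n (v : 'rV[R]_n.+1 -> R) z y := v (rVcons (z, y)).

Lemma L2sq_slice n (v : 'rV[R]_n.+1 -> R) : measurable_fun setT v ->
  L2sq v = (\int[lebesgue_measure]_z L2sq (slice v z))%E.
Proof.
move=> mv; rewrite /L2sq ge0_integral_rVS//.
  by apply/measurable_EFinP; exact: measurable_funX.
by move=> x; rewrite lee_fin sqr_ge0.
Qed.

Lemma measurable_L2sq_slice n (v : 'rV[R]_n.+1 -> R) : measurable_fun setT v ->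
  measurable_fun setT (fun z => L2sq (slice v z)).
Proof.
move=> mv.
apply: (measurable_fun_slice_integral (f := fun x => (v x ^+ 2)%:E)).
  by apply/measurable_EFinP; exact: measurable_funX.
by move=> x; rewrite lee_fin sqr_ge0.
Qed.

Lemma C1c_slice n (v : 'rV[R]_n.+1 -> R) z : C1c v -> C1c (slice v z).
Proof.
move=> [cv dv cdv [M vM]]; split.
- by move=> y; apply: continuous_comp; [exact: continuous_rVcons_r|exact: cv].
- by move=> k x; apply: derivable_slice_r; exact: dv.
- move=> k; rewrite (_ : partial k _ = slice (partial (lift ord0 k) v) z).
    by move=> y; apply: continuous_comp; [exact: continuous_rVcons_r|exact: cdv].
  by apply/funext => y; exact: partial_slice_r.
- exists M => x i xi; have [v0 dv0] : v (rVcons (z, x)) = 0 /\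
      forall k, partial k v (rVcons (z, x)) = 0.
    by apply: (vM _ (lift ord0 i)); rewrite rVconsS.
  by split=> // k; rewrite partial_slice_r.
Qed.

Lemma partial_slice n (v : 'rV[R]_n.+1 -> R) z k :
  partial k (slice v z) = slice (partial (lift ord0 k) v) z.
Proof. by apply/funext => y; exact: partial_slice_r. Qed.

Lemma C1c_measurable n (v : 'rV[R]_n -> R) : C1c v -> measurable_fun setT v.
Proof. by case=> cv _ _ _; exact: continuous_measurable_rV. Qed.

Lemma C1c_partial_measurable n (v : 'rV[R]_n -> R) k : C1c v ->
  measurable_fun setT (partial k v).
Proof. by case=> _ _ cdv _; exact: continuous_measurable_rV. Qed.

Lemma C1c_L2sq_lty n (v : 'rV[R]_n -> R) : C1c v -> (L2sq v < +oo)%E.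
Proof.
by case=> cv _ _ [M vM]; apply: (integral_sqr_lty (M := M)) => // x i /vM[].
Qed.

Lemma C1c_L2sq_partial_lty n (v : 'rV[R]_n -> R) k : C1c v ->
  (L2sq (partial k v) < +oo)%E.
Proof.
case=> _ _ cdv [M vM]; apply: (integral_sqr_lty (M := M)) => // x i /vM[_].
exact.
Qed.

(** [sqr_le_integral_derive] on each line parallel to the first axis, integrated over the other
    coordinates. The right-hand side does not depend on [z], so it can be taken out of integrals
    over slices. *)
Lemma L2sq_slice_le n (v : 'rV[R]_n.+1 -> R) z (e : R) : 0 < e -> C1c v ->
  (L2sq (slice v z) <= e%:E * L2sq (partial ord0 v) + e^-1%:E * L2sq v)%E.
Proof.
move=> e0 Cv; have mv := C1c_measurable Cv; have mdv := C1c_partial_measurable ord0 Cv.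
have e0' : 0 <= e by exact: ltW.
pose K x := e * partial ord0 v x ^+ 2 + e^-1 * v x ^+ 2.
have K0 x : 0 <= K x by rewrite addr_ge0// mulr_ge0 ?sqr_ge0 ?invr_ge0.
have mK : measurable_fun setT K.
  by apply: measurable_funD; apply: measurable_funM => //;
    (try exact: measurable_cst); exact: measurable_funX.
have -> : (e%:E * L2sq (partial ord0 v) + e^-1%:E * L2sq v)%E =
    (\int[leb n.+1]_x (K x)%:E)%E.
  under [RHS]eq_integral do rewrite /K EFinD (EFinM e) (EFinM e^-1).
  have Zl (c : R) (g : 'rV[R]_n.+1 -> R) : 0 <= c -> measurable_fun setT g ->
      (\int[leb n.+1]_x (c%:E * (g x ^+ 2)%:E) = c%:E * L2sq g)%E.
    move=> c0 mg; apply: ge0_integralZl_EFin => //.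
      by move=> x _; rewrite lee_fin sqr_ge0.
    by apply/measurable_EFinP; exact: measurable_funX.
  rewrite ge0_integralD ?Zl ?invr_ge0//.
  - by move=> x _; rewrite -EFinM lee_fin mulr_ge0// sqr_ge0.
  - apply: emeasurable_funM; first exact: measurable_cst.
    by apply/measurable_EFinP; exact: measurable_funX.
  - by move=> x _; rewrite -EFinM lee_fin mulr_ge0 ?invr_ge0// sqr_ge0.
  - apply: emeasurable_funM; first exact: measurable_cst.
    by apply/measurable_EFinP; exact: measurable_funX.
have mKE : measurable_fun setT (EFin \o K) by exact/measurable_EFinP.
rewrite ge0_integral_rVS2//; apply: ge0_le_integral => //.
- by move=> y _; rewrite lee_fin sqr_ge0.
- apply/measurable_EFinP; apply: measurable_funX.
  exact: C1c_measurable (C1c_slice _ Cv).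
- exact: (measurable_fun_slice_integral2 (f := EFin \o K)).
- move=> y _; have [cv dv cdv [M vM]] := Cv.
  have DE s : derive1 (fun s => v (rVcons (s, y))) s = partial ord0 v (rVcons (s, y)).
    exact: partial_slice_l.
  have := @sqr_le_integral_derive R (fun s => v (rVcons (s, y))) M e e0.
  under eq_integral do rewrite DE; apply.
  + by move=> s; apply: derivable_slice_l; exact: dv.
  + rewrite (_ : derive1 _ = fun s => partial ord0 v (rVcons (s, y))).
      by move=> s; apply: continuous_comp; [exact: continuous_rVcons_l|exact: cdv].
    exact/funext.
  + by move=> s Ms; apply: (vM _ ord0 _).1; rewrite rVcons0.
Qed.

End compactly_supported.

(** With g = i + a + b, the choice e = sqrt (i / g) makes both factors at most 2 sqrt (i g). *)
Lemma optimize_scale (R : realType) (X i a b : R) :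
  0 <= i -> 0 <= a -> 0 <= b ->
  (forall e, 0 < e -> X <= (e * a + e^-1 * i) * (e * b + e^-1 * i)) ->
  X <= 4 * i * (i + a + b).
Proof.
move=> i0 a0 b0 H; set g := i + a + b.
have g0 : 0 <= g by rewrite !addr_ge0.
(* [i] and [g] may be 0, so both are shifted by d > 0 before taking e = p / q; d tends to 0
   afterwards. *)
have Hd d : 0 < d -> X <= 4 * (i + d) * (g + d).
  move=> d0.
  have p0 : 0 < i + d by rewrite ltr_wpDl.
  have q0 : 0 < g + d by rewrite ltr_wpDl.
  set p := Num.sqrt (i + d); set q := Num.sqrt (g + d).
  have sp : p * p = i + d by rewrite -expr2 sqr_sqrtr// ltW.
  have sq : q * q = g + d by rewrite -expr2 sqr_sqrtr// ltW.
  have p0' : 0 < p by rewrite sqrtr_gt0.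
  have q0' : 0 < q by rewrite sqrtr_gt0.
  have e0 : 0 < p / q by rewrite divr_gt0.
  have A c : 0 <= c -> c <= g -> 0 <= p / q * c + (p / q)^-1 * i <= 2 * (p * q).
    move=> c0 cg; apply/andP; split.
      by rewrite addr_ge0// mulr_ge0 ?invr_ge0// ltW.
    have -> : 2 * (p * q) = p / q * (q * q) + (p / q)^-1 * (p * p).
      by field; rewrite !gt_eqF.
    rewrite sp sq; apply: lerD; rewrite ler_wpM2l ?invr_ge0 ?(ltW e0)//; lra.
  have /andP[A0 A1] := A a a0 ltac:(rewrite /g; lra).
  have /andP[B0 B1] := A b b0 ltac:(rewrite /g; lra).
  apply: le_trans (H _ e0) _; apply: (le_trans (ler_pM A0 B0 A1 B1)).
  rewrite -sp -sq le_eqVlt; apply/orP; left; apply/eqP; ring.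
apply/ler_addgt0Pr => eps eps0.
(* 4 (i + d) (g + d) exceeds 4 i g by d s - 4 d (1 - d), which is at most d s when d <= 1; hence the
   minimum of 1 and eps / s. *)
set s := 4 * (i + g + 1).
have s0 : 0 < s by rewrite /s; lra.
have d0 : 0 < Num.min 1 (eps / s) by rewrite lt_min ltr01 divr_gt0.
apply: le_trans (Hd _ d0) _; set d := Num.min _ _ in d0 *.
have d1 : d <= 1 by rewrite ge_min lexx.
have ds : d * s <= eps by rewrite -ler_pdivlMr// ge_min lexx orbT.
have dd : 0 <= d * (1 - d) by rewrite mulr_ge0 ?subr_ge0// ltW.
have -> : 4 * (i + d) * (g + d) = 4 * i * g + d * s - 4 * (d * (1 - d)).
  rewrite /s; ring.
lra.
Qed.

Lemma ge0_integralZlD3 d (T : measurableType d) (R : realType)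
    (mu : {measure set T -> \bar R}) (K : \bar R) (a b c : T -> \bar R) :
  (0 <= K)%E -> (forall x, 0 <= a x)%E -> (forall x, 0 <= b x)%E ->
  (forall x, 0 <= c x)%E ->
  measurable_fun setT a -> measurable_fun setT b -> measurable_fun setT c ->
  (\int[mu]_x (K * (a x + b x + c x)) =
   K * (\int[mu]_x a x + \int[mu]_x b x + \int[mu]_x c x))%E.
Proof.
move=> K0 a0 b0 c0 ma mb mc.
have mab := emeasurable_funD ma mb.
have ab0 x : (0 <= a x + b x)%E by rewrite adde_ge0.
rewrite -[in RHS]ge0_integralD// -[in RHS]ge0_integralD// ge0_integralZl//.
  exact: emeasurable_funD.
by move=> x _; rewrite adde_ge0.
Qed.

Section ladyzhenskaya.
Context {R : realType}.
Local Notation leb := (lebesgue_rV R).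
Local Open Scope ereal_scope.

Definition L4int n (v : 'rV[R]_n -> R) := \int[leb n]_x (v x ^+ 4)%:E.

Lemma L4int_ge0 n (v : 'rV[R]_n -> R) : 0 <= L4int v.
Proof. by apply: integral_ge0 => x _; rewrite lee_fin expr4_ge0. Qed.

Lemma L4int_slice n (v : 'rV[R]_n.+1 -> R) : measurable_fun setT v ->
  L4int v = \int[lebesgue_measure]_z L4int (slice v z).
Proof.
move=> mv; rewrite /L4int ge0_integral_rVS//.
  by apply/measurable_EFinP; exact: measurable_funX.
by move=> x; rewrite lee_fin expr4_ge0.
Qed.

Lemma measurable_L4int_slice n (v : 'rV[R]_n.+1 -> R) : measurable_fun setT v ->
  measurable_fun setT (fun z => L4int (slice v z)).
Proof.
move=> mv.
apply: (measurable_fun_slice_integral (f := fun x => (v x ^+ 4)%:E)).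
  by apply/measurable_EFinP; exact: measurable_funX.
by move=> x; rewrite lee_fin expr4_ge0.
Qed.

(** Base of the induction: in dimension 0 the measure is a Dirac mass, and v^4 = v^2 v^2. One of
    these two factors is then bounded uniformly in [z] to reach dimension 1. *)
Lemma L4int0 (v : 'rV[R]_0 -> R) : measurable_fun setT v ->
  L4int v = L2sq v * L2sq v.
Proof.
move=> mv; rewrite /L4int /L2sq !integral_dirac//.
- by rewrite diracT !mul1e -EFinM -exprD.
- by apply/measurable_EFinP; exact: measurable_funX.
- by apply/measurable_EFinP; exact: measurable_funX.
Qed.

(* [e] is kept free in dimensions 1 and 2, to be optimized afterwards *)
Lemma L4int1_le (v : 'rV[R]_1 -> R) (e : R) : (0 < e)%R -> C1c v ->
  L4int v <= (e%:E * L2sq (partial ord0 v) + e^-1%:E * L2sq v) * L2sq v.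
Proof.
move=> e0 Cv; have mv := C1c_measurable Cv.
set K := (X in X * _).
have K0 : 0 <= K.
  by rewrite adde_ge0// mule_ge0 ?lee_fin ?invr_ge0 ?(ltW e0)// L2sq_ge0.
rewrite L4int_slice// [in leRHS](L2sq_slice mv) -ge0_integralZl//.
- apply: ge0_le_integral => //.
  + by move=> z _; exact: L4int_ge0.
  + exact: measurable_L4int_slice.
  + by apply: emeasurable_funM; [exact: measurable_cst|exact: measurable_L2sq_slice].
  + move=> z _; rewrite L4int0; last exact: C1c_measurable (C1c_slice _ Cv).
    by apply: lee_wpmul2r; [exact: L2sq_ge0|exact: L2sq_slice_le].
- exact: measurable_L2sq_slice.
- by move=> z _; exact: L2sq_ge0.
Qed.

Lemma integral_L2sq_partial_slice n (v : 'rV[R]_n.+1 -> R) k : C1c v ->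
  \int[lebesgue_measure]_z L2sq (partial k (slice v z)) =
  L2sq (partial (lift ord0 k) v).
Proof.
move=> Cv; rewrite L2sq_slice; last exact: C1c_partial_measurable.
by apply: eq_integral => z _; rewrite (partial_slice v z k).
Qed.

Lemma measurable_L2sq_partial_slice n (v : 'rV[R]_n.+1 -> R) k : C1c v ->
  measurable_fun setT (fun z => L2sq (partial k (slice v z))).
Proof.
move=> Cv; rewrite (_ : (fun _ => _) =
    fun z => L2sq (slice (partial (lift ord0 k) v) z)).
  by apply: measurable_L2sq_slice; exact: C1c_partial_measurable.
by apply/funext => z; rewrite (partial_slice v z k).
Qed.

(** [L4int1_le] on each slice bounds it by a product of two factors. The factor [L2sq (slice v z)]
    is bounded uniformly in [z] by [L2sq_slice_le] and taken out as [K]; the other one is integrated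
    in [z]. *)
Lemma L4int2_le_scale (v : 'rV[R]_2 -> R) (e : R) : (0 < e)%R -> C1c v ->
  L4int v <= (e%:E * L2sq (partial ord0 v) + e^-1%:E * L2sq v) *
             (e%:E * L2sq (partial (lift ord0 ord0) v) + e^-1%:E * L2sq v).
Proof.
move=> e0 Cv; have mv := C1c_measurable Cv.
have ei0 : (0 <= e^-1)%R by rewrite invr_ge0 ltW.
have ee0 := ltW e0.
set K := (X in X * _).
have K0 : 0 <= K by rewrite adde_ge0// mule_ge0 ?lee_fin// L2sq_ge0.
have m1 : measurable_fun setT
    (fun z => e%:E * L2sq (partial ord0 (slice v z))).
  by apply: emeasurable_funM; [exact: measurable_cst|exact: measurable_L2sq_partial_slice].
have m2 : measurable_fun setT (fun z => e^-1%:E * L2sq (slice v z)).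
  by apply: emeasurable_funM; [exact: measurable_cst|exact: measurable_L2sq_slice].
rewrite -(integral_L2sq_partial_slice ord0 Cv) [in X in _ <= _ * X](L2sq_slice mv).
rewrite -ge0_integralZl_EFin//; last 2 first.
  by move=> z _; exact: L2sq_ge0.
  exact: measurable_L2sq_partial_slice.
rewrite -ge0_integralZl_EFin//; last 2 first.
  by move=> z _; exact: L2sq_ge0.
  exact: measurable_L2sq_slice.
rewrite -ge0_integralD//; last 2 first.
  by move=> z _; rewrite mule_ge0 ?lee_fin// L2sq_ge0.
  by move=> z _; rewrite mule_ge0 ?lee_fin// L2sq_ge0.
rewrite -ge0_integralZl//; last 2 first.
  exact: emeasurable_funD.
  by move=> z _; rewrite adde_ge0// mule_ge0 ?lee_fin// L2sq_ge0.
rewrite L4int_slice//; apply: ge0_le_integral => //.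
- by move=> z _; exact: L4int_ge0.
- exact: measurable_L4int_slice.
- by apply: emeasurable_funM; [exact: measurable_cst|exact: emeasurable_funD].
- move=> z _; apply: le_trans (L4int1_le e0 (C1c_slice z Cv)) _.
  rewrite [leRHS]muleC; apply: lee_wpmul2l; last exact: L2sq_slice_le.
  by rewrite adde_ge0// mule_ge0 ?lee_fin// L2sq_ge0.
Qed.

(** The factor [L2sq v] carries no derivative: this is what can be bounded uniformly over the slices
    of a function of three variables. With a fixed [e], the product of the two partial derivative
    terms would remain. *)
Lemma L4int2_le (v : 'rV[R]_2 -> R) : C1c v ->
  L4int v <= 4%:E * L2sq v *
    (L2sq v + L2sq (partial ord0 v) + L2sq (partial (lift ord0 ord0) v)).
Proof.
move=> Cv.
have fin w : L2sq w < +oo -> exists2 r, (0 <= r)%R & @L2sq R 2 w = r%:E.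
  move=> woo; exists (fine (L2sq w)); first by rewrite fine_ge0// L2sq_ge0.
  by rewrite fineK// ge0_fin_numE// L2sq_ge0.
have [i i0 iE] := fin _ (C1c_L2sq_lty Cv).
have [a a0 aE] := fin _ (C1c_L2sq_partial_lty ord0 Cv).
have [b b0 bE] := fin _ (C1c_L2sq_partial_lty (lift ord0 ord0) Cv).
have H e : (0 < e)%R ->
    L4int v <= ((e * a + e^-1 * i) * (e * b + e^-1 * i))%:E.
  by move=> e0; have := L4int2_le_scale e0 Cv; rewrite iE aE bE.
(* The bound at e = 1 gives finiteness, which allows the optimization to take place in [R]. *)
have Xfin : L4int v \is a fin_num.
  rewrite ge0_fin_numE ?L4int_ge0//; apply: le_lt_trans (H 1%R ltr01) _.
  exact: ltry.
rewrite iE aE bE -(fineK Xfin) -!EFinM lee_fin; apply: optimize_scale => // e e0.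
by rewrite -lee_fin fineK//; exact: H.
Qed.

Definition H1sq n (v : 'rV[R]_n -> R) :=
  L2sq v + \sum_(k < n) L2sq (partial k v).

(** [L4int2_le] on each slice; its derivative-free factor is bounded by [L2sq_slice_le] at e = 1,
    and the remaining sum is integrated in [z]. *)
Lemma L4int3_le (v : 'rV[R]_3 -> R) : C1c v ->
  L4int v <= 4%:E * (L2sq (partial ord0 v) + L2sq v) *
    (L2sq v + L2sq (partial (lift ord0 ord0) v) +
     L2sq (partial (lift ord0 (lift ord0 ord0)) v)).
Proof.
move=> Cv; have mv := C1c_measurable Cv.
set K := (X in X * _).
have K0 : 0 <= K by rewrite mule_ge0 ?lee_fin// adde_ge0 ?L2sq_ge0.
have mI := measurable_L2sq_slice mv.
have mD0 := measurable_L2sq_partial_slice ord0 Cv.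
have mD1 := measurable_L2sq_partial_slice (lift ord0 ord0) Cv.
have mS := emeasurable_funD mI mD0.
have g0 z := L2sq_ge0 (slice v z).
have g1 z := L2sq_ge0 (partial ord0 (slice v z)).
have g2 z := L2sq_ge0 (partial (lift ord0 ord0) (slice v z)).
rewrite -(integral_L2sq_partial_slice ord0 Cv).
rewrite -(integral_L2sq_partial_slice (lift ord0 ord0) Cv).
rewrite [in X in _ <= _ * X](L2sq_slice mv).
rewrite -(ge0_integralZlD3 lebesgue_measure K0 g0 g1 g2 mI mD0 mD1).
rewrite L4int_slice//; apply: ge0_le_integral => //.
- by move=> z _; exact: L4int_ge0.
- exact: measurable_L4int_slice.
- apply: emeasurable_funM; first exact: measurable_cst.
  exact: emeasurable_funD mS mD1.
- move=> z _; apply: le_trans (L4int2_le (C1c_slice z Cv)) _.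
  apply: lee_wpmul2r; first by rewrite adde_ge0// adde_ge0.
  apply: lee_wpmul2l; first by rewrite lee_fin.
  by have := L2sq_slice_le z ltr01 Cv; rewrite invr1 !mul1e.
Qed.

Theorem L4int_le n (v : 'rV[R]_n -> R) : (0 < n <= 3)%N -> C1c v ->
  L4int v <= 4%:E * (H1sq v * H1sq v).
Proof.
have S2 (F : 'I_2 -> \bar R) : \sum_(k < 2) F k = F ord0 + F (lift ord0 ord0).
  by rewrite !big_ord_recl big_ord0 adde0.
have S3 (F : 'I_3 -> \bar R) : \sum_(k < 3) F k =
    F ord0 + (F (lift ord0 ord0) + F (lift ord0 (lift ord0 ord0))).
  by rewrite !big_ord_recl big_ord0 adde0.
(* [B1], [B2], [B3] weaken the bounds in dimensions 1, 2, 3 to a common form: every factor is at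
   most [H1sq], and 4 is the constant of dimensions 2 and 3. *)
have B1 (i a : \bar R) : 0 <= i -> 0 <= a ->
    (a + i) * i <= 4%:E * ((i + a) * (i + a)).
  move=> i0 a0; rewrite -[leLHS]mul1e addeC; have ai : 0 <= i + a by rewrite adde_ge0.
  apply: lee_pmul => //; [exact: mule_ge0|by rewrite lee_fin; lra|].
  by apply: lee_pmul => //; rewrite leeDl.
have B2 (i a b : \bar R) : 0 <= i -> 0 <= a -> 0 <= b ->
    4%:E * i * (i + a + b) <= 4%:E * ((i + (a + b)) * (i + (a + b))).
  move=> i0 a0 b0; rewrite -muleA -addeA; have ab : 0 <= a + b by rewrite adde_ge0.
  apply: lee_wpmul2l; first by rewrite lee_fin.
  by apply: lee_pmul => //; [rewrite adde_ge0|rewrite leeDl].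
have B3 (i a b c : \bar R) : 0 <= i -> 0 <= a -> 0 <= b -> 0 <= c ->
    4%:E * (a + i) * (i + b + c) <=
    4%:E * ((i + (a + (b + c))) * (i + (a + (b + c)))).
  move=> i0 a0 b0 c0; rewrite -muleA -addeA; have bc : 0 <= b + c by rewrite adde_ge0.
  apply: lee_wpmul2l; first by rewrite lee_fin.
  apply: lee_pmul; [by rewrite adde_ge0|by rewrite adde_ge0| |].
    by rewrite addeC leeD2l// leeDl.
  by rewrite leeD2l// leeDr.
case: n v => [|[|[|[|n]]]] v // _ Cv; rewrite /H1sq.
- apply: le_trans (L4int1_le ltr01 Cv) _.
  by rewrite invr1 !mul1e big_ord1; apply: B1; exact: L2sq_ge0.
- apply: le_trans (L4int2_le Cv) _.
  by rewrite S2; apply: B2; exact: L2sq_ge0.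
- apply: le_trans (L4int3_le Cv) _.
  by rewrite S3; apply: B3; exact: L2sq_ge0.
Qed.

End ladyzhenskaya.

(** * Square integrable functions *)

Section square_integrable.
Context d (T : measurableType d) (R : realType).
Variables (mu : {measure set T -> \bar R}) (D : set T) (mD : measurable D).
Implicit Types f g h u w : T -> R.

Definition sqint u :=
  measurable_fun D u /\ mu.-integrable D (EFin \o (fun x => u x ^+ 2)).

Definition int_sqr u : \bar R := (\int[mu]_(x in D) (u x ^+ 2)%:E)%E.

Lemma int_sqr_ge0 u : (0 <= int_sqr u)%E.
Proof. by apply: integral_ge0 => x _; rewrite lee_fin sqr_ge0. Qed.

Lemma measurable_sqr u : measurable_fun D u ->
  measurable_fun D (fun x => (u x ^+ 2)%:E).
Proof. by move=> mu'; apply/measurable_EFinP; exact: measurable_funX. Qed.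

Lemma measurable_scale_EFin (c : R) u : measurable_fun D u ->
  measurable_fun D (fun x => c%:E * (u x)%:E)%E.
Proof.
move=> mu'; apply: emeasurable_funM; first exact: measurable_cst.
exact/measurable_EFinP.
Qed.

(** Linear combinations are taken throughout in the form u + t w, that of the lines along which the
    functionals are differentiated; t = -1 gives differences. *)
Lemma measurable_lin u w (t : R) : measurable_fun D u -> measurable_fun D w ->
  measurable_fun D (fun x => u x + t * w x).
Proof.
move=> mu' mw; apply: measurable_funD => //; apply: measurable_funM => //.
Qed.

Lemma sqintP u : sqint u <-> measurable_fun D u /\ (int_sqr u < +oo)%E.
Proof.
split=> -[mu' h]; split=> //; last first.
  apply/integrableP; split; first exact: measurable_sqr.
  by under eq_integral do rewrite /= ger0_norm ?sqr_ge0//.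
by move/integrableP: h => [_]; under eq_integral do rewrite /= ger0_norm ?sqr_ge0//.
Qed.

Lemma int_sqrE u : sqint u ->
  int_sqr u = (\int[mu]_(x in D) (u x ^+ 2))%:E.
Proof.
by move=> [_ iu]; rewrite /int_sqr /Rintegral fineK//; exact: integrable_fin_num.
Qed.

Lemma le_integrable_sqr h u w : measurable_fun D h -> sqint u -> sqint w ->
  (forall x, D x -> `|h x| <= u x ^+ 2 + w x ^+ 2) ->
  mu.-integrable D (EFin \o h).
Proof.
move=> mh [_ iu] [_ iw] huw.
apply: (le_integrable mD (g := EFin \o (fun x => u x ^+ 2 + w x ^+ 2))).
- exact/measurable_EFinP.
- by move=> x Dx /=; rewrite lee_fin [leRHS]ger0_norm ?addr_ge0 ?sqr_ge0//; exact: huw.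
- exact: (integrableD mD iu iw).
Qed.

Lemma sqint_mul u w : sqint u -> sqint w ->
  mu.-integrable D (EFin \o (fun x => u x * w x)).
Proof.
move=> su sw; apply: (le_integrable_sqr _ su sw).
  by apply: measurable_funM; [case: su|case: sw].
move=> x _; have := sqr_ge0 (u x + w x); have := sqr_ge0 (u x - w x).
rewrite ler_norml sqrrB sqrrD => h1 h2; apply/andP.
have := sqr_ge0 (u x); have := sqr_ge0 (w x); split; lra.
Qed.

Lemma int_sqr_lin_le u w (t : R) : measurable_fun D u -> measurable_fun D w ->
  (int_sqr (fun x => u x + t * w x)%R <=
   2%:E * int_sqr u + (2 * t ^+ 2)%:E * int_sqr w)%E.
Proof.
move=> mu' mw; rewrite /int_sqr.
have t0 : 0 <= 2 * t ^+ 2 by rewrite mulr_ge0 ?sqr_ge0.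
have s0 f x : D x -> (0 <= (f x ^+ 2)%:E)%E by rewrite lee_fin sqr_ge0.
rewrite -ge0_integralZl_EFin//; [|exact: s0|exact: measurable_sqr].
rewrite -ge0_integralZl_EFin//; [|exact: s0|exact: measurable_sqr].
rewrite -ge0_integralD//; first apply: ge0_le_integral => //.
- exact: s0.
- by apply: measurable_sqr; exact: measurable_lin.
- by apply: emeasurable_funD; apply: measurable_scale_EFin; exact: measurable_funX.
- move=> x _; rewrite -!EFinM -EFinD lee_fin.
  have := sqr_ge0 (u x - t * w x); rewrite sqrrB sqrrD exprMn; lra.
- by move=> x _; rewrite -EFinM lee_fin mulr_ge0// sqr_ge0.
- by apply: measurable_scale_EFin; exact: measurable_funX.
- by move=> x _; rewrite -EFinM lee_fin mulr_ge0// sqr_ge0.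
- by apply: measurable_scale_EFin; exact: measurable_funX.
Qed.

Lemma sqint_lin u w (t : R) : sqint u -> sqint w -> sqint (fun x => u x + t * w x).
Proof.
move=> /sqintP[mu' uoo] /sqintP[mw woo]; apply/sqintP; split.
  exact: measurable_lin.
apply: le_lt_trans (int_sqr_lin_le t mu' mw) _.
apply: lte_add_pinfty; apply: lte_mul_pinfty => //.
by rewrite lee_fin mulr_ge0 ?sqr_ge0.
Qed.

Lemma integrable_lin u w (t : R) : mu.-integrable D (EFin \o u) ->
  mu.-integrable D (EFin \o w) ->
  mu.-integrable D (EFin \o (fun x => u x + t * w x)).
Proof. by move=> iu iw; exact: (integrableD mD iu (integrableZl mD t iw)). Qed.

Lemma Rintegral_lin u w (t : R) : mu.-integrable D (EFin \o u) ->
  mu.-integrable D (EFin \o w) ->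
  \int[mu]_(x in D) (u x + t * w x) =
  \int[mu]_(x in D) u x + t * \int[mu]_(x in D) w x.
Proof.
move=> iu iw; rewrite -RintegralZl// RintegralD//.
exact: (integrableZl mD t iw).
Qed.

(** Convergence to 0 in L^2, stated on the squared norm so as to avoid the square root of [Lnorm];
    [cvg_L2P] makes the link. *)
Definition L2_small (w_ : nat -> T -> R) :=
  forall e : R, 0 < e -> \forall n \near \oo, (int_sqr (w_ n) <= e%:E)%E.

Lemma L2_small_lin (v_ w_ : nat -> T -> R) (t : R) :
  (forall n, measurable_fun D (v_ n)) -> (forall n, measurable_fun D (w_ n)) ->
  L2_small v_ -> L2_small w_ -> L2_small (fun n x => v_ n x + t * w_ n x).
Proof.
move=> mv mw Hv Hw e e0.
have c0 : 0 < 2 * t ^+ 2 + 1 by rewrite ltr_wpDl// mulr_ge0 ?sqr_ge0.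
(* Each of the two terms of [int_sqr_lin_le] is to be at most e / 2; the + 1 in the next denominator
   covers t = 0. *)
have e1 : 0 < e / 4 by rewrite divr_gt0.
have e2 : 0 < e / 2 / (2 * t ^+ 2 + 1) by rewrite !divr_gt0.
near=> n; apply: le_trans (int_sqr_lin_le t (mv n) (mw n)) _.
apply: (@le_trans _ _ (2%:E * (e / 4)%:E +
    (2 * t ^+ 2)%:E * (e / 2 / (2 * t ^+ 2 + 1))%:E)%E).
  apply: leeD; apply: lee_wpmul2l.
  - by rewrite lee_fin.
  - by near: n; exact: (Hv _ e1).
  - by rewrite lee_fin mulr_ge0 ?sqr_ge0.
  - by near: n; exact: (Hw _ e2).
rewrite -!EFinM -EFinD lee_fin.
have : (2 * t ^+ 2 + 1) * (e / 2 / (2 * t ^+ 2 + 1)) = e / 2.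
  by rewrite mulrC divfK// gt_eqF.
have e2' := e2; rewrite mulrDl mul1r => h; lra.
Unshelve. all: by end_near. Qed.

(** By orthogonality |h|^2 <= |h|^2 + |p_n|^2 = |h - p_n|^2, which tends to 0. *)
Lemma orthogonal_limit_eq0 h (p_ : nat -> T -> R) :
  sqint h -> (forall n, sqint (p_ n)) ->
  (forall n, \int[mu]_(x in D) (h x * p_ n x) = 0) ->
  L2_small (fun n x => h x - p_ n x) ->
  {ae mu, forall x, D x -> h x = 0}.
Proof.
move=> sh sp hp0 hp; have [mh ih] := sh.
have le n : (int_sqr h <= int_sqr (fun x => h x - p_ n x)%R)%E.
  have shp : sqint (fun x => h x - p_ n x).
    have := sqint_lin (-1) sh (sp n); congr sqint; apply/funext => x.
    by rewrite mulN1r.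
  have [mhp ihp] := shp; have ihpn := sqint_mul sh (sp n).
  rewrite !int_sqrE// lee_fin.
  have -> : \int[mu]_(x in D) (h x ^+ 2) = \int[mu]_(x in D) (h x ^+ 2 - 2 * (h x * p_ n x)).
    have i2 : mu.-integrable D (EFin \o (fun x => 2 * (h x * p_ n x))).
      exact: (integrableZl mD 2 ihpn).
    by rewrite RintegralB// RintegralZl// hp0 mulr0 subr0.
  apply: le_Rintegral => //.
    have i2 : mu.-integrable D (EFin \o (fun x => 2 * (h x * p_ n x))).
      exact: (integrableZl mD 2 ihpn).
    exact: (integrableB mD ih i2).
  by move=> x _; have := sqr_ge0 (p_ n x); rewrite sqrrB; lra.
have h0 : int_sqr h = 0%E.
  apply/eqP; rewrite eq_le int_sqr_ge0 andbT.
  apply/lee_addgt0Pr => e e0; rewrite add0e.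
  by near \oo => n; apply: le_trans (le n) _; near: n; exact: hp.
have : ae_eq mu D (fun x => (h x ^+ 2)%:E) (cst 0%E).
  apply/ae_eq_integral_abs => //; first exact: measurable_sqr.
  by under eq_integral do rewrite gee0_abs ?lee_fin ?sqr_ge0//.
apply: filterS => x /[apply] /= -[] /eqP.
by rewrite sqrf_eq0 => /eqP.
Unshelve. all: by end_near. Qed.

Definition fourth_int u :=
  measurable_fun D u /\ mu.-integrable D (EFin \o (fun x => u x ^+ 4)).

(* For each truncation level K,
   u^2 min(u^2, K) <= 16 w^4 + 4 K (u - w)^2,
   so that bounds in L^4 pass to L^2 limits without extracting a subsequence. *)
Lemma fourth_int_limit u (C : R) : measurable_fun D u ->
  (forall e : R, 0 < e -> exists w, [/\ measurable_fun D w,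
     (int_sqr (fun x => w x - u x)%R <= e%:E)%E &
     (\int[mu]_(x in D) (w x ^+ 4)%:E <= C%:E)%E]) ->
  fourth_int u.
Proof.
move=> mu' H; split=> //.
pose g (K : nat) x := u x ^+ 2 * Num.min (u x ^+ 2) K%:R.
have min0 x (K : nat) : 0 <= Num.min (u x ^+ 2) K%:R by rewrite le_min sqr_ge0 ler0n.
have g0 K x : 0 <= g K x by rewrite mulr_ge0 ?sqr_ge0.
have mg K : measurable_fun D (g K).
  apply: measurable_funM; first exact: measurable_funX.
  by apply: measurable_minr; [exact: measurable_funX|exact: measurable_cst].
have g_le K x (y : R) : g K x <= 16 * y ^+ 4 + 4 * K%:R * (y - u x) ^+ 2.
  rewrite /g; set a := u x.
  have m0 := min0 x K; rewrite -/a in m0; set m := Num.min _ _ in m0 *.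
  have m1 : m <= a ^+ 2 by rewrite ge_min lexx.
  have m2 : m <= K%:R by rewrite ge_min lexx orbT.
  have K0 : 0 <= K%:R :> R by [].
  have a2 := sqr_ge0 a; have w4 := expr4_ge0 y; have wa := sqr_ge0 (y - a).
  (* Either |a| <= 2 |y|, and a^4 <= 16 y^4; or |y| < |a| / 2, whence |a| <= 2 |y - a|, and the
     truncation supplies the factor [K]. *)
  have [h|h] := leP (a ^+ 2) (4 * y ^+ 2).
    apply: (@le_trans _ _ (16 * y ^+ 4)); last by rewrite lerDl mulr_ge0// mulr_ge0.
    apply: (@le_trans _ _ ((4 * y ^+ 2) * (4 * y ^+ 2))).
      by apply: ler_pM => //; exact: le_trans h.
    by rewrite (_ : 4 * y ^+ 2 * (4 * y ^+ 2) = 16 * y ^+ 4)//; ring.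
  apply: (@le_trans _ _ (4 * K%:R * (y - a) ^+ 2)); last by rewrite lerDr mulr_ge0.
  have h' : a ^+ 2 <= 4 * (y - a) ^+ 2.
    have : `|y| * 2 <= `|a|.
      rewrite -(ler_pXn2r (n := 2))// ?nnegrE ?mulr_ge0//.
      by rewrite exprMn !real_normK ?num_real//; lra.
    move=> wa2.
    have : `|a| <= `|y - a| * 2.
      have := lerB_dist a y; rewrite distrC; lra.
    rewrite -(ler_pXn2r (n := 2))// ?nnegrE ?mulr_ge0//.
    by rewrite exprMn !real_normK ?num_real//; lra.
  have -> : 4 * K%:R * (y - a) ^+ 2 = 4 * (y - a) ^+ 2 * K%:R by ring.
  exact: ler_pM.
have ig K : (\int[mu]_(x in D) (g K x)%:E <= (16 * C)%:E)%E.
  apply/lee_addgt0Pr => e e0.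
  have e1 : 0 < e / (4 * K%:R + 1) by rewrite divr_gt0// ltr_wpDl.
  have [w [mw we wC]] := H _ e1.
  have mwu : measurable_fun D (fun x => w x - u x) by exact: measurable_funB.
  have mw4 : measurable_fun D (fun x => (w x ^+ 4)%:E).
    by apply/measurable_EFinP; exact: measurable_funX.
  apply: (@le_trans _ _ (\int[mu]_(x in D)
      (16%:E * (w x ^+ 4)%:E + (4 * K%:R)%:E * ((w x - u x) ^+ 2)%:E))%E).
    apply: ge0_le_integral => //.
    - by move=> x _; rewrite lee_fin.
    - exact/measurable_EFinP.
    - apply: emeasurable_funD; apply: measurable_scale_EFin; exact: measurable_funX.
    - by move=> x _; rewrite -!EFinM -EFinD lee_fin.
  rewrite ge0_integralD//; last 4 first.
    by move=> x _; rewrite -EFinM lee_fin mulr_ge0// expr4_ge0.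
    by apply: measurable_scale_EFin; exact: measurable_funX.
    by move=> x _; rewrite -EFinM lee_fin mulr_ge0 ?sqr_ge0// mulr_ge0.
    by apply: measurable_scale_EFin; exact: measurable_funX.
  rewrite !ge0_integralZl_EFin//; try exact: measurable_sqr;
    try by move=> x _; rewrite lee_fin ?sqr_ge0 ?expr4_ge0.
  apply: leeD; first by rewrite EFinM lee_wpmul2l.
  apply: (@le_trans _ _ ((4 * K%:R)%:E * (e / (4 * K%:R + 1))%:E)%E).
    by apply: lee_wpmul2l => //; rewrite lee_fin.
  rewrite -EFinM lee_fin mulrC -[leRHS](@divfK _ (4 * K%:R + 1)) ?gt_eqF ?ltr_wpDl//.
  by rewrite ler_wpM2l ?(ltW e1)// lerDl.
apply/integrableP; split.
  by apply/measurable_EFinP; exact: measurable_funX.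
under eq_integral do rewrite /= ger0_norm ?expr4_ge0//.
(* At a fixed [x] the truncation is inactive as soon as K >= u(x)^2, so the sequence is eventually
   constant; it is nondecreasing in [K], as monotone convergence requires. *)
have lim x : (u x ^+ 4)%:E = limn (fun K => (g K x)%:E).
  apply/esym/cvg_lim => //; apply: cvg_near_cst.
  near=> K; rewrite /g; congr EFin.
  have /min_idPl -> : u x ^+ 2 <= K%:R by near: K; exact: nbhs_infty_ger.
  by rewrite -exprD.
under eq_integral do rewrite lim.
rewrite monotone_convergence//.
- apply: (@le_lt_trans _ _ (16 * C)%:E); last exact: ltry.
  apply: lime_le; last by apply: nearW => K; exact: ig.
  apply: ereal_nondecreasing_is_cvgn => m n mn; apply: ge0_le_integral => //.
  + by move=> x _; rewrite lee_fin.
  + exact/measurable_EFinP.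
  + exact/measurable_EFinP.
  + move=> x _; rewrite lee_fin ler_wpM2l ?sqr_ge0//.
    by rewrite le_min ge_min lexx/= ge_min ler_nat mn orbT.
- by move=> K; exact/measurable_EFinP.
- by move=> K x _; rewrite lee_fin.
- move=> x _ m n mn; rewrite lee_fin ler_wpM2l ?sqr_ge0//.
  by rewrite le_min ge_min lexx/= ge_min ler_nat mn orbT.
Unshelve. all: by end_near. Qed.

End square_integrable.

(** * The space H01 *)

Section test_functions.
Context {R : realType} {N : nat} (Omega : set 'rV[R]_N).
Local Notation E := 'rV[R]_N.
Implicit Types u v w phi psi : E -> R.

Lemma partial_lin (k : 'I_N) u v (t : R) (x : E) :
  derivable u x (delta_mx ord0 k) -> derivable v x (delta_mx ord0 k) ->
  derivable (fun x => u x + t * v x) x (delta_mx ord0 k) /\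
  partial k (fun x => u x + t * v x) x = partial k u x + t * partial k v x.
Proof.
move=> du dv.
have Du : is_derive x (delta_mx ord0 k) u (partial k u x) by exact: derivableP.
have Dv : is_derive x (delta_mx ord0 k) v (partial k v x) by exact: derivableP.
have D : is_derive x (delta_mx ord0 k) (u + t *: v)
    (partial k u x + t *: partial k v x) by apply: is_deriveD.
by split; [exact: (@ex_derive _ _ _ _ _ _ _ D)|exact: (@derive_val _ _ _ _ _ _ _ D)].
Qed.

Lemma foldr_partial_lin u v (t : R) (s : seq 'I_N) : smooth u -> smooth v ->
  foldr partial (fun x => u x + t * v x) s =
  fun x => foldr partial u s x + t * foldr partial v s x.
Proof.
move=> su sv; elim: s => //= k s ->; apply/funext => x.
by apply: (partial_lin _ _ _).2; [apply: (su s).2|apply: (sv s).2].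
Qed.

Lemma smooth_lin u v (t : R) : smooth u -> smooth v ->
  smooth (fun x => u x + t * v x).
Proof.
move=> su sv s du; rewrite {}/du foldr_partial_lin//; split.
  have [cu _] := su s; have [cv _] := sv s.
  move=> x; apply: (@cvgD _ _ _ (nbhs x)); first exact: cu.
  by apply: (@cvgM _ _ (nbhs x)); [exact: cvg_cst|exact: cv].
by move=> x k; apply: (partial_lin _ _ _).1; [apply: (su s).2|apply: (sv s).2].
Qed.

Lemma sub_test_function u v : smooth v -> test_function Omega u ->
  closure [set x | v x != 0] `<=` closure [set x | u x != 0] ->
  test_function Omega v.
Proof.
move=> sv [_ cu uO] uv; split => //; last exact: subset_trans uO.
exact: subclosed_compact (@closed_closure _ _) cu uv.
Qed.

Lemma test_function_lin u v (t : R) : test_function Omega u ->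
  test_function Omega v -> test_function Omega (fun x => u x + t * v x).
Proof.
move=> [su cu uO] [sv cv vO].
have sub : closure [set x | u x + t * v x != 0] `<=`
    closure [set x | u x != 0] `|` closure [set x | v x != 0].
  rewrite -closureU; apply: closure_subset => x /=.
  have [->|] := eqVneq (u x) 0; last by left.
  by rewrite add0r mulf_eq0 negb_or => /andP[_]; right.
split; first exact: smooth_lin.
- apply: subclosed_compact sub; first exact: closed_closure.
  exact: compactU.
- by apply: subset_trans sub _ => x [/uO|/vO].
Qed.

Lemma test_function0 : test_function Omega (fun=> 0).
Proof.
have e : [set x : E | (0 : R) != 0] = set0.
  by rewrite -subset0 => x /=; rewrite eqxx.
split; [|by rewrite e closure0; exact: compact0|by rewrite e closure0].
have z (s : seq 'I_N) : foldr partial (fun=> 0 : R) s = fun=> 0.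
  by elim: s => //= k s ->; apply/funext => x; exact: derive_cst.
move=> s du; rewrite {}/du z; split; first exact: cst_continuous.
by move=> x k; exact: derivable_cst.
Qed.

Lemma smooth_partial u (k : 'I_N) : smooth u -> smooth (partial k u).
Proof. by move=> su s; have := su (rcons s k); rewrite foldr_rcons. Qed.

Lemma partial_eq0 u (k : 'I_N) (x : E) : ~ closure [set x | u x != 0] x ->
  partial k u x = 0.
Proof.
move=> xu; rewrite /partial (@near_eq_derive _ _ _ _ (fun=> 0)).
  exact: derive_cst.
have : nbhs x (~` closure [set x | u x != 0]).
  by apply: open_nbhs_nbhs; split=> //; apply: closed_openC; exact: closed_closure.
apply: filterS => y; apply: contra_notP => /eqP uy; exact: subset_closure.
Qed.

Lemma test_function_partial u (k : 'I_N) : test_function Omega u ->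
  test_function Omega (partial k u).
Proof.
move=> tu; have [su _ _] := tu.
apply: (sub_test_function (smooth_partial k su) tu).
rewrite [X in _ `<=` X](closure_id _).1; last exact: closed_closure.
apply: closure_subset => x /=; apply: contra_neqP => xu; exact: partial_eq0.
Qed.

Lemma test_function_eq0 u x : test_function Omega u -> ~ Omega x -> u x = 0.
Proof.
move=> [_ _ uO]; apply: contra_notP => /eqP ux; apply: uO; exact: subset_closure.
Qed.

Lemma test_function_C1c u : test_function Omega u -> C1c u.
Proof.
move=> tu; have [su cu uO] := tu; split.
- exact: (su [::]).1.
- by move=> k x; apply: (su [::]).2.
- by move=> k; exact: (su [:: k]).1.
- have [M [_ uM]] := compact_bounded cu.
  (* [compact_bounded] bounds the support by every number above [M], in particular M + 1; a
     coordinate of size at least M + 2 makes the sup norm of [x] larger than that. *)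
  exists (M + 2) => x i xi.
  have xu : ~ closure [set x | u x != 0] x.
    move=> /(uM (M + 1)); rewrite ltrDl => /(_ ltr01).
    apply/negP; rewrite -ltNge; apply: lt_le_trans (_ : M + 2 <= _); first lra.
    apply: le_trans xi _; rewrite [leRHS]/Num.Def.normr/= mx_normrE.
    by apply: (@le_bigmax _ _ _ _ (fun ij => `|x ij.1 ij.2|) (ord0, i)).
  split; last by move=> k; exact: partial_eq0.
  by apply: contra_notP xu => /eqP ux; exact: subset_closure.
Qed.

End test_functions.

Lemma poweR_half_le (R : realType) (x : \bar R) (e : R) : (0 <= x)%E -> 0 <= e ->
  (x `^ 2^-1 <= e%:E)%E = (x <= (e ^+ 2)%:E)%E.
Proof.
case: x => [r r0 e0|_ _|]; last by rewrite leeNy_eq.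
  rewrite poweR_EFin !lee_fin powR12_sqrt//.
  transitivity (Num.sqrt r <= Num.sqrt (e ^+ 2)).
    by rewrite sqrtr_sqr ger0_norm.
  by rewrite ler_sqrt ?sqr_ge0.
by rewrite poweRyr ?invr_neq0// !leye_eq.
Qed.

Lemma cvg0_nneg_ereal (R : realType) (f : nat -> \bar R) : (forall n, 0 <= f n)%E ->
  f @ \oo --> 0%E <-> forall e : R, 0 < e -> \forall n \near \oo, (f n <= e%:E)%E.
Proof.
move=> f0; split.
  move=> /fine_cvgP[ff /cvgrPdist_le f0'] e e0; near=> n.
  have fn : f n \is a fin_num by near: n; exact: ff.
  rewrite -(fineK fn) lee_fin; apply: le_trans (ler_norm _) _.
  have : `|0 - (fine \o f) n| <= e by near: n; exact: f0'.
  by rewrite sub0r normrN.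
move=> H; apply/fine_cvgP; split.
  near=> n; rewrite ge0_fin_numE//; apply: le_lt_trans (ltry 1).
  by near: n; exact: H.
apply/cvgrPdist_le => e e0; near=> n.
have fe : (f n <= e%:E)%E by near: n; exact: H.
have fn : f n \is a fin_num.
  by rewrite ge0_fin_numE//; apply: le_lt_trans fe (ltry _).
by rewrite sub0r normrN ger0_norm ?fine_ge0//= -lee_fin fineK.
Unshelve. all: by end_near. Qed.

(** * Weak gradients in H01 and the embedding into L^4 *)

Section H01_space.
Context {R : realType} {N : nat} (Omega : set 'rV[R]_N).
Hypothesis oO : open Omega.
Local Notation E := 'rV[R]_N.
Local Notation leb := (lebesgue_rV R N).
Implicit Types (u v w phi psi : E -> R) (g h : 'I_N -> E -> R).
Let mO : measurable Omega := open_measurable_rV oO.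

Lemma Lnorm2E w : ('N[leb]_(2%:E)[EFin \o (w \_ Omega)%R] =
  int_sqr leb Omega w `^ 2^-1)%E.
Proof.
rewrite unlock /int_sqr; congr (_ `^ _)%E.
rewrite [RHS]integral_mkcond; apply: eq_integral => x _ /=.
rewrite !patchE; case: ifPn => _; last by rewrite normr0 powR0.
by rewrite powR_mulrn// real_normK ?num_real.
Qed.

Lemma Lp2P u : Lp Omega 2%:E u <-> sqint leb Omega u.
Proof.
rewrite (sqintP leb); split=> [|[mu' uoo]].
  move=> /andP[]; rewrite !inE/= /finite_norm Lnorm2E => mu' uoo.
  split; first exact/(measurable_restrictT _ mO).
  move: uoo => /(poweR_lty 2); rewrite -poweRrM mulVf// poweRe1//.
  exact: int_sqr_ge0.
apply/andP; split; rewrite inE/=; first exact/(measurable_restrictT _ mO).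
by rewrite /finite_norm Lnorm2E; exact: poweR_lty.
Qed.

Lemma cvg_L2P (phi_ : nat -> E -> R) u :
  cvg_L2 Omega phi_ u <-> L2_small leb Omega (fun n x => phi_ n x - u x).
Proof.
rewrite /cvg_L2 cvg0_nneg_ereal; last by move=> n; exact: Lnorm_ge0.
split=> H e e0.
  have se0 : 0 < Num.sqrt e by rewrite sqrtr_gt0.
  have := H _ se0; apply: filterS => n; rewrite Lnorm2E.
  by rewrite poweR_half_le ?int_sqr_ge0 ?(ltW se0)// sqr_sqrtr// ltW.
have e20 : 0 < e ^+ 2 by rewrite exprn_gt0.
have := H _ e20; apply: filterS => n; rewrite Lnorm2E.
by rewrite poweR_half_le ?int_sqr_ge0// ltW.
Qed.

Lemma test_function_sqint psi : test_function Omega psi -> sqint leb Omega psi.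
Proof.
move=> tp; have Cp := test_function_C1c tp; apply/sqintP.
have mp := C1c_measurable Cp; split; first exact: measurable_funTS.
apply: le_lt_trans (C1c_L2sq_lty Cp); apply: ge0_subset_integral => //.
- exact: measurable_sqr.
- by move=> x _; rewrite lee_fin sqr_ge0.
Qed.

Lemma L2sq_test_function psi : test_function Omega psi ->
  L2sq psi = int_sqr leb Omega psi.
Proof.
move=> tp; rewrite /L2sq /int_sqr [RHS]integral_mkcond; apply: eq_integral => x _.
rewrite patchE; case: ifPn => // /negP; rewrite inE => xO.
by rewrite (test_function_eq0 tp)// expr0n.
Qed.

Lemma H01_gradientP u g : H01_gradient Omega u g <->
  [/\ sqint leb Omega u, forall k, sqint leb Omega (g k), weak_gradient Omega u g &
      exists phi_ : nat -> E -> R, [/\ forall n, test_function Omega (phi_ n),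
        L2_small leb Omega (fun n x => phi_ n x - u x) &
        forall k, L2_small leb Omega (fun n x => partial k (phi_ n) x - g k x)]].
Proof.
split=> -[su sg wg [p_ [tp pu pg]]]; split=> //.
- exact/Lp2P.
- by move=> k; exact/Lp2P.
- by exists p_; split=> // [|k]; exact/cvg_L2P.
- exact/Lp2P.
- by move=> k; exact/Lp2P.
- by exists p_; split=> // [|k]; exact/cvg_L2P.
Qed.

Lemma H01_gradient_lin u w g h (t : R) :
  H01_gradient Omega u g -> H01_gradient Omega w h ->
  H01_gradient Omega (fun x => u x + t * w x) (fun k x => g k x + t * h k x).
Proof.
move=> /H01_gradientP[su sg wg [p_ [tp pu pg]]].
move=> /H01_gradientP[sw sh wh [q_ [tq qw qh]]].
apply/H01_gradientP; split.
- exact: sqint_lin.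
- by move=> k; exact: sqint_lin.
- move=> k psi tpsi.
  have sp := test_function_sqint tpsi.
  have sdp := test_function_sqint (test_function_partial k tpsi).
  under eq_Rintegral do rewrite mulrDl -mulrA.
  rewrite (Rintegral_lin mO t (sqint_mul mO su sdp) (sqint_mul mO sw sdp)).
  under [in RHS]eq_Rintegral do rewrite mulrDl -mulrA.
  rewrite (Rintegral_lin mO t (sqint_mul mO (sg k) sp) (sqint_mul mO (sh k) sp)).
  by rewrite wg// wh// mulrN opprD.
- exists (fun n x => p_ n x + t * q_ n x); split.
  + by move=> n; exact: test_function_lin.
  + have -> : (fun n x => p_ n x + t * q_ n x - (u x + t * w x)) =
        (fun n x => (p_ n x - u x) + t * (q_ n x - w x)).
      by apply/funext => n; apply/funext => x; ring.
    apply: L2_small_lin => // n; apply: measurable_funB; try by case: su; case: sw.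
      by have [] := test_function_sqint (tp n).
    by have [] := test_function_sqint (tq n).
  + move=> k.
    have -> : (fun n x => partial k (fun x => p_ n x + t * q_ n x) x -
          (g k x + t * h k x)) =
        (fun n x => (partial k (p_ n) x - g k x) + t * (partial k (q_ n) x - h k x)).
      apply/funext => n; apply/funext => x.
      have [sp _ _] := tp n; have [sq _ _] := tq n.
      by rewrite (partial_lin _ ((sp [::]).2 x k) ((sq [::]).2 x k)).2; ring.
    have [mg _] := sg k; have [mh _] := sh k.
    apply: L2_small_lin => // n; apply: measurable_funB => //.
      by have [] := test_function_sqint (test_function_partial k (tp n)).
    by have [] := test_function_sqint (test_function_partial k (tq n)).
Qed.

Lemma H01_gradient0 : H01_gradient Omega (fun=> 0) (fun _ _ => 0).
Proof.
have s0 := test_function_sqint (test_function0 Omega).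
have d0 k : partial k (fun=> 0 : R) = (fun=> 0 : R) :> (E -> R).
  by apply/funext => x; exact: derive_cst.
have i0 : int_sqr leb Omega (fun=> 0 - 0 : R) = 0%E.
  by rewrite /int_sqr; under eq_integral do rewrite subr0 expr0n/=; rewrite integral0.
apply/H01_gradientP; split=> //.
  move=> k psi _; under eq_Rintegral do rewrite mul0r.
  by under [in RHS]eq_Rintegral do rewrite mul0r; rewrite /Rintegral integral0 oppr0.
exists (fun _ _ => 0); split.
- by move=> n; exact: test_function0.
- by move=> e e0; apply: nearW => n; rewrite i0 lee_fin ltW.
- by move=> k e e0; apply: nearW => n; rewrite d0 i0 lee_fin ltW.
Qed.

(* The partial derivatives of test functions are test functions, so the weak
   gradient of the difference is orthogonal to a sequence converging to it. *)
Lemma H01_gradient_unique u w g h : H01_gradient Omega u g ->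
  H01_gradient Omega w h -> ae_in Omega (fun x => u x = w x) ->
  forall k, ae_in Omega (fun x => g k x = h k x).
Proof.
move=> Hu Hw uw k.
have /H01_gradientP[sv sf wf [p_ [tp _ pf]]] := H01_gradient_lin (-1) Hu Hw.
have tdp n := test_function_partial k (tp n).
suff : {ae leb, forall x, Omega x -> g k x + -1 * h k x = 0}.
  by apply: filterS => x /[apply] /eqP; rewrite mulN1r subr_eq0 => /eqP.
apply: (orthogonal_limit_eq0 mO (sf k) (p_ := fun n => partial k (p_ n))).
- by move=> n; exact: test_function_sqint.
(* The weak gradient identity of u - w, tested with the k-th partial derivative of [p_ n], moves the
   derivative onto the test function; the integral then contains u - w, which vanishes a.e. *)
- move=> n; apply/eqP; rewrite -oppr_eq0 -(wf k _ (tdp n)); apply/eqP.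
  rewrite /Rintegral; have sddp := test_function_sqint (test_function_partial k (tdp n)).
  have mv : measurable_fun Omega (fun x =>
      ((u x + -1 * w x) * partial k (partial k (p_ n)) x)%:E).
    exact: measurable_int (sqint_mul mO sv sddp).
  rewrite (ae_eq_integral (cst 0%E) _ mO mv)//; first by rewrite integral0.
  move: uw; rewrite /ae_in; apply: filterS => x /[apply] /= ->.
  by rewrite mulN1r subrr mul0r.
- move=> e e0; have := pf k _ e0; apply: filterS => n; congr (_ <= _)%E.
  by apply: eq_integral => x _; congr EFin; ring.
Qed.

Lemma gradP u : H01 Omega u -> H01_gradient Omega u (grad Omega u).
Proof. by move=> [g Hg]; apply: getPex; exists g. Qed.

Lemma H01_lin u w (t : R) : H01 Omega u -> H01 Omega w ->
  H01 Omega (fun x => u x + t * w x).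
Proof. by move=> [g Hg] [h Hh]; eexists; exact: H01_gradient_lin Hg Hh. Qed.

(** [grad] chooses a representative for each function separately, so its linearity is an a.e.
    statement and comes from uniqueness. *)
Lemma grad_lin u w (t : R) k : H01 Omega u -> H01 Omega w ->
  ae_in Omega (fun x => grad Omega (fun y => u y + t * w y) k x =
                        grad Omega u k x + t * grad Omega w k x).
Proof.
move=> Hu Hw; have Hl := H01_gradient_lin t (gradP Hu) (gradP Hw).
apply: H01_gradient_unique (gradP (H01_lin t Hu Hw)) Hl _ _.
exact: aeW.
Qed.

Lemma grad_eq0 u k : H01 Omega u -> ae_in Omega (fun x => u x = 0) ->
  ae_in Omega (fun x => grad Omega u k x = 0).
Proof.
move=> Hu u0; exact: (H01_gradient_unique (gradP Hu) H01_gradient0 u0 k).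
Qed.

Lemma H01_sqint u : H01 Omega u -> sqint leb Omega u.
Proof. by move=> /gradP/H01_gradientP[]. Qed.

Lemma grad_sqint u k : H01 Omega u -> sqint leb Omega (grad Omega u k).
Proof. by move=> /gradP/H01_gradientP[]. Qed.

Lemma int_sqr_near_le u w : measurable_fun Omega w -> sqint leb Omega u ->
  (int_sqr leb Omega (fun x => w x - u x)%R <= 1)%E ->
  (int_sqr leb Omega w <= 2%:E + 2%:E * int_sqr leb Omega u)%E.
Proof.
move=> mw [mu' _] wu1.
have mwu : measurable_fun Omega (fun x => w x - u x) by exact: measurable_funB.
have := int_sqr_lin_le leb mO 1 mwu mu'; rewrite expr1n mulr1.
have -> : (fun x => w x - u x + 1 * u x) = w.
  by apply/funext => x; rewrite mul1r subrK.
move/le_trans; apply; apply: leeD => //.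
by rewrite -[leRHS]mule1 lee_wpmul2l// lee_fin.
Qed.

(** The approximating test functions are eventually bounded in H^1, hence in L^4 by [L4int_le], and
    [fourth_int_limit] transfers the bound to their L^2 limit. *)
Theorem H01_fourth_int u : (0 < N <= 3)%N -> H01 Omega u -> fourth_int leb Omega u.
Proof.
move=> N3 /gradP/H01_gradientP[su sg _ [p_ [tp pu pg]]].
pose C : \bar R := ((2%:E + 2%:E * int_sqr leb Omega u) +
  \sum_(k < N) (2%:E + 2%:E * int_sqr leb Omega (grad Omega u k)))%E.
have fin w : sqint leb Omega w -> (2%:E + 2%:E * int_sqr leb Omega w)%E \is a fin_num.
  by move=> sw; rewrite int_sqrE// -EFinM -EFinD.
have Cfin : C \is a fin_num.
  by rewrite fin_numD fin//=; apply/sum_fin_numP => k _; rewrite fin.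
apply: (fourth_int_limit mO (C := 4 * (fine C * fine C))); first by case: su.
move=> e e0.
(* Distance at most e is what [fourth_int_limit] asks for; distance at most 1 bounds the H^1 norm of
   [p_ n] by [C], which must not depend on e. *)
have e1 : 0 < Num.min e 1 by rewrite lt_min e0 ltr01.
near \oo => n.
have Hu : (int_sqr leb Omega (fun x => p_ n x - u x)%R <= (Num.min e 1)%:E)%E.
  by near: n; exact: pu.
have Hg k : (int_sqr leb Omega (fun x => partial k (p_ n) x - grad Omega u k x)%R <=
    (Num.min e 1)%:E)%E.
  by move: k; near: n; apply: filter_forall => k; exact: pg.
have tpn := tp n; have Cp := test_function_C1c tpn.
exists (p_ n); split.
- by have [] := test_function_sqint tpn.
- by apply: le_trans Hu _; rewrite lee_fin ge_min lexx.
- have min1 : ((Num.min e 1)%:E <= 1)%E by rewrite lee_fin ge_min lexx orbT.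
  have H1C : (H1sq (p_ n) <= C)%E.
    rewrite /H1sq L2sq_test_function//; apply: leeD.
      apply: int_sqr_near_le => //; last exact: le_trans Hu min1.
      by have [] := test_function_sqint tpn.
    apply: lee_sum => k _; have tdp := test_function_partial k tpn.
    rewrite L2sq_test_function//; apply: int_sqr_near_le => //.
      by have [] := test_function_sqint tdp.
    exact: le_trans (Hg k) min1.
  have H10 : (0 <= H1sq (p_ n))%E.
    by rewrite adde_ge0 ?L2sq_ge0// sume_ge0// => k _; exact: L2sq_ge0.
  apply: (@le_trans _ _ (L4int (p_ n))).
    apply: ge0_subset_integral => //.
      apply/measurable_EFinP; apply: measurable_funX; exact: C1c_measurable.
    by move=> x _; rewrite lee_fin expr4_ge0.
  apply: le_trans (L4int_le N3 Cp) _.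
  rewrite !EFinM (fineK Cfin); apply: lee_wpmul2l; first by rewrite lee_fin.
  exact: lee_pmul.
Unshelve. all: by end_near. Qed.

End H01_space.

(** * Differentiation of the energy *)

Lemma ae_eq_Rintegral d (T : measurableType d) (R : realType)
    (mu : {measure set T -> \bar R}) (D : set T) (f g : T -> R) :
  measurable D -> measurable_fun D f -> measurable_fun D g ->
  {ae mu, forall x, D x -> f x = g x} ->
  \int[mu]_(x in D) f x = \int[mu]_(x in D) g x.
Proof.
move=> mD mf mg fg; congr fine; apply: ae_eq_integral => //.
- exact/measurable_EFinP.
- exact/measurable_EFinP.
- by apply: filterS fg => x /[apply] ->.
Qed.

Lemma Rintegral_sum d (T : measurableType d) (R : realType)
    (mu : {measure set T -> \bar R}) (D : set T) (I : finType) (f : I -> T -> R) :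
  measurable D -> (forall i, mu.-integrable D (EFin \o f i)) ->
  \int[mu]_(x in D) (\sum_i f i x) = \sum_i \int[mu]_(x in D) f i x.
Proof.
move=> mD fi.
have iS (s : seq I) : mu.-integrable D (EFin \o (fun x => \sum_(i <- s) f i x)).
  elim: s => [|i s IH].
    apply: (@eq_integrable _ _ _ mu D mD (cst 0%E)); last exact: integrable0.
    by move=> x _ /=; rewrite big_nil.
  apply: eq_integrable (integrableD mD (fi i) IH) => // x _ /=.
  by rewrite big_cons.
elim: (index_enum I) => [|i s IH].
  under eq_Rintegral do rewrite big_nil.
  by rewrite big_nil /Rintegral integral0.
under eq_Rintegral do rewrite big_cons.
by rewrite big_cons RintegralD// IH.
Qed.

Lemma is_derive_bigsum (R : realType) (I : finType) (P : pred I)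
    (f : I -> R -> R) (l : I -> R) :
  (forall i, is_derive (0 : R) (1 : R) (f i) (l i)) ->
  is_derive (0 : R) (1 : R) (fun t => \sum_(i | P i) f i t) (\sum_(i | P i) l i).
Proof.
move=> H; elim: (index_enum I) => [|i s IH].
  under eq_fun do rewrite big_nil.
  by rewrite big_nil; exact: is_derive_cst.
under eq_fun do rewrite big_cons.
rewrite big_cons; case: ifP => // _.
exact: (is_deriveD (H i) IH).
Qed.

(** Reads a derivative at 0 off a polynomial in Horner form: [l] is the coefficient of t, and [r]
    collects the higher ones. *)
Lemma is_derive_linear_remainder (R : realType) (f r : R -> R) (c l : R) :
  (forall t, f t = c + t * (l + t * r t)) -> derivable r 0 1 ->
  is_derive (0 : R) (1 : R) f l.
Proof.
move=> /funext -> dr.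
have Dr : is_derive (0 : R) (1 : R) r ('D_1 r 0) by exact: derivableP.
by apply: is_derive_eq; rewrite /GRing.scale/=; ring.
Qed.

(** * Quartic integrals along lines *)

Section quartic.
Context d (T : measurableType d) (R : realType).
Variables (mu : {measure set T -> \bar R}) (D : set T) (mD : measurable D).
Implicit Types (b u v w phi psi : T -> R).

Definition ae_bounded b := measurable_fun D b /\
  exists M : R, {ae mu, forall x, D x -> `|b x| <= M}.

Lemma ae_boundedM b f : ae_bounded b -> mu.-integrable D (EFin \o f) ->
  mu.-integrable D (EFin \o (fun x => b x * f x)).
Proof.
move=> [mb [M bM]] fi; have mf : measurable_fun D f.
  exact/measurable_EFinP/(measurable_int mu).
have mbf : measurable_fun D (fun x => b x * f x) by exact: measurable_funM.
have iMf := integrableZl mD `|M| fi.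
apply/integrableP; split; first exact/measurable_EFinP.
move/integrableP : iMf => [mMf]; apply: le_lt_trans.
apply: ae_ge0_le_integral => //.
- by apply: measurableT_comp => //; exact/measurable_EFinP.
- exact: measurableT_comp.
- apply: filterS bM => x /[apply] bxM; rewrite /= lee_fin !normrM normr_id.
  by rewrite ler_wpM2r//; apply: le_trans bxM (ler_norm _).
Qed.

(** The inequality |a c| <= (a^2 + c^2) / 2, applied twice, bounds the product by the sum of the
    fourth powers, which takes the place of Hoelder's inequality. *)
Lemma quad_integrable u v w phi : fourth_int mu D u -> fourth_int mu D v ->
  fourth_int mu D w -> fourth_int mu D phi ->
  mu.-integrable D (EFin \o (fun x => u x * v x * w x * phi x)).
Proof.
move=> [m1 i1] [m2 i2] [m3 i3] [m4 i4].
have iS := integrableD mD (integrableD mD (integrableD mD i1 i2) i3) i4.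
apply: le_integrable iS => //.
  by apply/measurable_EFinP; do 3 apply: measurable_funM => //.
move=> x _ /=; rewrite lee_fin.
have amgm (a c : R) : `|a * c| <= (a ^+ 2 + c ^+ 2) / 2.
  have := sqr_ge0 (a - c); have := sqr_ge0 (a + c); rewrite ler_norml sqrrB sqrrD.
  by move=> h1 h2; apply/andP; split; lra.
set a := u x; set b := v x; set c := w x; set e := phi x.
rewrite [leRHS]ger0_norm; last by rewrite !addr_ge0// expr4_ge0.
have h := amgm (a * b) (c * e); rewrite mulrA in h; apply: (le_trans h).
have sq2 (y z : R) : (y * z) ^+ 2 <= (y ^+ 4 + z ^+ 4) / 2.
  have := amgm (y ^+ 2) (z ^+ 2); rewrite -exprMn -!exprM/= => h'.
  exact: le_trans (ler_norm _) h'.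
have := sq2 a b; have := sq2 c e.
have := expr4_ge0 a; have := expr4_ge0 b; have := expr4_ge0 c; have := expr4_ge0 e.
lra.
Qed.

(** The weighted 4-linear form behind every quartic term. Its linearity is proved in the second and
    fourth slots, where [quartic_diff] places the direction. *)
Definition qint b u v w phi : R :=
  \int[mu]_(x in D) (b x * (u x * v x * w x * phi x)).

Lemma qint_lin2 b u v w phi psi (s : R) : ae_bounded b ->
  fourth_int mu D u -> fourth_int mu D v -> fourth_int mu D w ->
  fourth_int mu D phi -> fourth_int mu D psi ->
  qint b u (fun x => v x + s * psi x) w phi = qint b u v w phi + s * qint b u psi w phi.
Proof.
move=> bb fu fv fw fp fs; rewrite /qint -Rintegral_lin//.
- by apply: eq_Rintegral => x _; ring.
- by apply: ae_boundedM => //; exact: quad_integrable.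
- by apply: ae_boundedM => //; exact: quad_integrable.
Qed.

Lemma qint_lin4 b u v w phi psi (s : R) : ae_bounded b ->
  fourth_int mu D u -> fourth_int mu D v -> fourth_int mu D w ->
  fourth_int mu D phi -> fourth_int mu D psi ->
  qint b u v w (fun x => phi x + s * psi x) = qint b u v w phi + s * qint b u v w psi.
Proof.
move=> bb fu fv fw fp fs; rewrite /qint -Rintegral_lin//.
- by apply: eq_Rintegral => x _; ring.
- by apply: ae_boundedM => //; exact: quad_integrable.
- by apply: ae_boundedM => //; exact: quad_integrable.
Qed.

Lemma is_derive_quartic b u v phi psi : ae_bounded b ->
  fourth_int mu D u -> fourth_int mu D v ->
  fourth_int mu D phi -> fourth_int mu D psi ->
  is_derive (0 : R) (1 : R)
    (fun t => \int[mu]_(x in D)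
       (b x * (u x + t * phi x) ^+ 2 * (v x + t * psi x) ^+ 2))
    (2 * qint b u phi v v + 2 * qint b u u v psi).
Proof.
move=> bb fu fv fp fs.
have I (f1 f2 f3 f4 : T -> R) : fourth_int mu D f1 -> fourth_int mu D f2 ->
    fourth_int mu D f3 -> fourth_int mu D f4 ->
    mu.-integrable D (EFin \o (fun x => b x * (f1 x * f2 x * f3 x * f4 x))).
  by move=> *; apply: ae_boundedM => //; exact: quad_integrable.
(* The digit in each name is the power of t that the term multiplies in the expansion of b (u + t
   phi)^2 (v + t psi)^2. *)
pose f0 x := b x * (u x * u x * v x * v x).
pose f1a x := b x * (u x * phi x * v x * v x).
pose f1b x := b x * (u x * u x * v x * psi x).
pose f2a x := b x * (phi x * phi x * v x * v x).
pose f2b x := b x * (u x * phi x * v x * psi x).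
pose f2c x := b x * (u x * u x * psi x * psi x).
pose f3a x := b x * (phi x * phi x * v x * psi x).
pose f3b x := b x * (u x * phi x * psi x * psi x).
pose f4 x := b x * (phi x * phi x * psi x * psi x).
have i0 : mu.-integrable D (EFin \o f0) by exact: I.
have z : mu.-integrable D (EFin \o (fun=> 0 : R)) by exact: integrable0.
(* The leading 0 gives each coefficient the shape that repeated use of [integrable_lin] and
   [Rintegral_lin] expects. *)
pose f1 x := (0 + 2 * f1a x) + 2 * f1b x.
have i1 : mu.-integrable D (EFin \o f1).
  by do 2 (apply: integrable_lin => //; last exact: I).
pose f2 x := ((0 + 1 * f2a x) + 4 * f2b x) + 1 * f2c x.
have i2 : mu.-integrable D (EFin \o f2).
  by do 3 (apply: integrable_lin => //; last exact: I).
pose f3 x := (0 + 2 * f3a x) + 2 * f3b x.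
have i3 : mu.-integrable D (EFin \o f3).
  by do 2 (apply: integrable_lin => //; last exact: I).
have i4 : mu.-integrable D (EFin \o f4) by exact: I.
pose J (f : T -> R) := \int[mu]_(x in D) f x.
have -> : 2 * qint b u phi v v + 2 * qint b u u v psi = J f1.
  rewrite /J /f1 Rintegral_lin//; last 2 first.
    by apply: integrable_lin => //; exact: I.
    exact: I.
  rewrite Rintegral_lin//; last exact: I.
  by congr (_ + _); rewrite /Rintegral integral0 add0r.
apply: (@is_derive_linear_remainder _ _ (fun t => J f2 + t * (J f3 + t * J f4)) (J f0)).
  move=> t.
  have i34 := integrable_lin mD t i3 i4.
  have i234 := integrable_lin mD t i2 i34.
  have i1234 := integrable_lin mD t i1 i234.
  rewrite -(Rintegral_lin mD t i3 i4) -(Rintegral_lin mD t i2 i34).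
  rewrite -(Rintegral_lin mD t i1 i234) -(Rintegral_lin mD t i0 i1234).
  apply: eq_Rintegral => x _.
  by rewrite /f0 /f1 /f2 /f3 /f4 /f1a /f1b /f2a /f2b /f2c /f3a /f3b; ring.
by apply: ex_derive.
Qed.

End quartic.

(** Levy-Desplanques theorem. The transpose appears because kernels consist of row vectors: v *m M^T
    = 0 says that [M] kills the column v. *)
Lemma diagonally_dominant_solve (R : realFieldType) m (M : 'M[R]_m) (c : 'I_m -> R) :
  (forall h, \sum_(k < m | k != h) `|M h k| < `|M h h|) ->
  exists t : 'I_m -> R, forall h, \sum_(k < m) M h k * t k = c h.
Proof.
move=> sdd.
have uM : M^T \in unitmx.
  rewrite -row_free_unit -kermx_eq0; apply/rowV0P => v /sub_kermxP vM.
  apply/eqP; apply: contraT => /rV0Pn[i0 vi0].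
  (* At an entry of largest modulus, row i of the kernel equation bounds |M_ii| |v_i| by the
     off-diagonal sum times |v_i|, against dominance in that row. *)
  pose i := [arg max_(i > i0) `|v ord0 i|]%O.
  have iP j : `|v ord0 j| <= `|v ord0 i| by rewrite /i; case: arg_maxP => // ? _; exact.
  have vi : 0 < `|v ord0 i| by apply: lt_le_trans (iP i0); rewrite normr_gt0.
  have : (v *m M^T) ord0 i = 0 by rewrite vM mxE.
  rewrite mxE (bigD1 i)//= mxE => /eqP; rewrite addr_eq0 => /eqP vME.
  have := ltr_pM2r vi (\sum_(k < m | k != i) `|M i k|) `|M i i|.
  rewrite sdd ltNge => /negP[].
  rewrite mulrC -normrM vME normrN mulr_suml.
  apply: le_trans (ler_norm_sum _ _ _) _; apply: ler_sum => k _.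
  by rewrite mxE normrM mulrC ler_wpM2l.
exists (fun k => ((\row_h c h) *m invmx M^T) ord0 k) => h.
transitivity (((\row_h c h) *m invmx M^T *m M^T) ord0 h).
  by rewrite [RHS]mxE; apply: eq_bigr => k _; rewrite [M^T _ _]mxE mulrC.
by rewrite mulmxKV// mxE.
Qed.

(** * The blocks partition the indices *)

Section decomposition.
Variables (d m : nat) (a : m.+1.-tuple nat).
Hypothesis da : is_decomposition d a.

Lemma block_exists (i : 'I_d) : exists h : 'I_m, block a h i.
Proof.
case/and3P: da => /eqP a0 /eqP am _.
(* The block of [i] ends at the first entry of [a] above [i]; induction on j finds it, and a_m = d
   starts it for every [i]. *)
suff : forall j, (j <= m)%N -> (i < nth 0%N a j)%N ->
    exists2 h, (h < j)%N & (nth 0%N a h <= i < nth 0 a h.+1)%N.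
  by move=> /(_ m (leqnn m)); rewrite am => /(_ (ltn_ord i))[h hm ?]; exists (Ordinal hm).
elim=> [|j IH] jm; first by rewrite a0.
have [ij|ji] := ltnP i (nth 0%N a j) => ij1.
  by have [h hj ?] := IH (ltnW jm) ij; exists h => //; exact: ltnW.
by exists j => //; rewrite ji ij1.
Qed.

Lemma block_inj (i : 'I_d) (h k : 'I_m) : block a h i -> block a k i -> h = k.
Proof.
case/and3P: da => _ _ sa.
have mono (p q : 'I_m) : (p < q)%N -> block a p i -> block a q i -> False.
  move=> pq /andP[_ ip] /andP[iq _].
  have pin : p.+1 \in gtn (size a) by rewrite inE size_tuple ltnS.
  have qin : (q : nat) \in gtn (size a) by rewrite inE size_tuple ltnS ltnW.
  have sa' : sorted leq a by exact: sub_sorted ltnW _ sa.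
  (* As p < q, block p ends at or before the start of block q. *)
  have pq' := sorted_leq_nth leq_trans leqnn 0%N sa' p.+1 q pin qin pq.
  have := leq_ltn_trans (leq_trans pq' iq) ip.
  by rewrite ltnn.
move=> hi ki; have [hk|kh|/val_inj//] := ltngtP h k.
  by case: (mono _ _ hk hi ki).
by case: (mono _ _ kh ki hi).
Qed.

Lemma sum_block (V : nmodType) (F : 'I_d -> V) :
  \sum_i F i = \sum_(h < m) \sum_(i | block a h i) F i.
Proof.
rewrite (exchange_big_dep predT)//=; apply: eq_bigr => i _.
have [h hi] := block_exists i; rewrite (big_pred1 h)// => k /=.
apply/idP/eqP => [ki|->//]; exact: block_inj ki hi.
Qed.

End decomposition.

Lemma Lpoo_ae_bounded (R : realType) N (Omega : set 'rV[R]_N) b : open Omega ->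
  Lp Omega +oo%E b -> ae_bounded (lebesgue_rV R N) Omega b.
Proof.
move=> oO; have mO := open_measurable_rV oO.
move=> /andP[]; rewrite !inE/= /finite_norm => mb boo.
split; first exact/(measurable_restrictT _ mO).
move: boo; rewrite unlock; case: ifPn => [_|mu0 _].
  have := ess_sup_ge (lebesgue_rV R N) (abse \o (EFin \o (b \_ Omega))).
  (* The value +oo contradicts finiteness of the norm; for the value -oo, the a.e. bound on a
     modulus is absurd, so any constant will do. *)
  case: (ess_sup _ _) => [r|//|] h _; [exists r|exists 0]; apply: filterS h => x /=.
    by rewrite lee_fin => + Ox; rewrite patchE mem_set.
  by rewrite leeNy_eq.
exists 0; exists setT; split => //.
by apply/eqP; rewrite -measure_le0 leNgt.
Qed.

(** * The quadratic part of the energy *)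

Section energy_derivatives.
Context {R : realType} {N : nat} (Omega : set 'rV[R]_N).
Hypothesis oO : open Omega.
Local Notation E := 'rV[R]_N.
Local Notation leb := (lebesgue_rV R N).
Implicit Types (V u w phi : E -> R).
Let mO : measurable Omega := open_measurable_rV oO.

Definition energy_density V u phi (x : E) : R :=
  (\sum_(k < N) grad Omega u k x * grad Omega phi k x) + V x * (u x * phi x).

Definition energy_form V u phi : R := \int[leb]_(x in Omega) energy_density V u phi x.

Lemma energy_density_integrable V u phi : ae_bounded leb Omega V ->
  H01 Omega u -> H01 Omega phi ->
  leb.-integrable Omega (EFin \o energy_density V u phi).
Proof.
move=> bV Hu Hp.
have iV : leb.-integrable Omega (EFin \o (fun x => V x * (u x * phi x))).
  by apply: ae_boundedM => //; apply: sqint_mul => //; exact: H01_sqint.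
have iG k : leb.-integrable Omega
    (EFin \o (fun x => grad Omega u k x * grad Omega phi k x)).
  by apply: sqint_mul => //; exact: grad_sqint.
have iS := integrable_sum mO (index_enum 'I_N) (P := predT) (fun k _ => iG k).
apply: eq_integrable (integrableD mO iS iV) => // x _.
by rewrite /energy_density /= EFinD sumEFin.
Qed.

Lemma normsqE V u : normsq Omega V u = energy_form V u u.
Proof.
apply: eq_Rintegral => x _; exact: erefl.
Qed.

Lemma energy_form_lin V u phi w (s : R) : ae_bounded leb Omega V ->
  H01 Omega u -> H01 Omega phi -> H01 Omega w ->
  energy_form V u (fun x => phi x + s * w x) = energy_form V u phi + s * energy_form V u w.
Proof.
move=> bV Hu Hp Hw; have Hl := H01_lin oO s Hp Hw.
have i1 := energy_density_integrable bV Hu Hp.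
have i2 := energy_density_integrable bV Hu Hw.
rewrite /energy_form -Rintegral_lin//; apply: ae_eq_Rintegral => //.
- by apply/measurable_EFinP; exact: (measurable_int leb (energy_density_integrable bV Hu Hl)).
- by apply/measurable_EFinP; exact: (measurable_int leb (integrable_lin mO s i1 i2)).
(* The exceptional null set must serve all k at once; there are finitely many. *)
- have : {ae leb, forall x, forall k, Omega x ->
      grad Omega (fun y => phi y + s * w y) k x =
      grad Omega phi k x + s * grad Omega w k x}.
    by apply: filter_forall => k; exact: grad_lin.
  apply: filterS => x gx Ox; rewrite /energy_density (mulrDr s) mulr_sumr addrACA.
  rewrite -big_split/=; congr (_ + _); last by ring.
  by apply: eq_bigr => k _; rewrite gx//; ring.
Qed.

Lemma energy_formC V u phi : energy_form V u phi = energy_form V phi u.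
Proof.
apply: eq_Rintegral => x _; rewrite /energy_density (mulrC (u x)); congr (_ + _).
by apply: eq_bigr => k _; rewrite mulrC.
Qed.

Lemma is_derive_normsq V u phi : ae_bounded leb Omega V ->
  H01 Omega u -> H01 Omega phi ->
  is_derive (0 : R) (1 : R) (fun t => normsq Omega V (fun x => u x + t * phi x))
    (2 * energy_form V u phi).
Proof.
move=> bV Hu Hp.
apply: (@is_derive_linear_remainder _ _ (fun=> energy_form V phi phi) (energy_form V u u)) => [t|].
  have Hl := H01_lin oO t Hu Hp.
  rewrite normsqE energy_form_lin// (energy_formC V _ u) (energy_formC V _ phi) !energy_form_lin//.
  by rewrite (energy_formC V phi u); ring.
exact: derivable_cst.
Qed.

End energy_derivatives.

(** * Critical points *)

(** Links the norms in [nehari] to the count of nonzero components: the chosen gradient of a null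
    function vanishes a.e. by uniqueness. *)
Lemma normsq_ae0 (R : realType) N (Omega : set 'rV[R]_N) (V u : 'rV[R]_N -> R) :
  open Omega -> ae_bounded (lebesgue_rV R N) Omega V -> H01 Omega u ->
  ae_in Omega (fun x => u x = 0) -> normsq Omega V u = 0.
Proof.
move=> oO bV Hu u0; have mO := open_measurable_rV oO.
set leb := lebesgue_rV R N in bV *; rewrite normsqE /energy_form (ae_eq_Rintegral (g := fun=> 0) mO).
- by rewrite /Rintegral integral0.
- by apply/measurable_EFinP; exact: (measurable_int leb (energy_density_integrable oO bV Hu Hu)).
- exact: measurable_cst.
- have : {ae leb, forall x, forall k, Omega x -> grad Omega u k x = 0}.
    by apply: filter_forall => k; exact: grad_eq0.
  move: u0; rewrite /ae_in; apply: filterS2 => x ux gx Ox.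
  rewrite /energy_density ux// mul0r mulr0 addr0 big1// => k _.
  by rewrite gx// mul0r.
Qed.

Section critical_points.
Context {R : realType} {N d m : nat} (Omega : set 'rV[R]_N).
Local Notation E := 'rV[R]_N.
Local Notation leb := (lebesgue_rV R N).
Variables (a : m.+1.-tuple nat) (V : 'I_d -> E -> R) (B : 'I_d -> 'I_d -> E -> R).
Hypotheses (oO : open Omega) (N3 : (0 < N <= 3)%N).
Hypothesis bV : forall i, ae_bounded leb Omega (V i).
Hypothesis bB : forall i j, ae_bounded leb Omega (B i j).
Implicit Types u phi : 'I_d -> E -> R.
Let mO : measurable Omega := open_measurable_rV oO.

Let f4 w : H01 Omega w -> fourth_int leb Omega w.
Proof. exact: H01_fourth_int. Qed.

(** Derivative at u, in direction phi, of the integral of B_ij u_i^2 u_j^2, as given by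
    [is_derive_quartic]. *)
Definition quartic_diff u phi (i j : 'I_d) : R :=
  2 * qint leb Omega (B i j) (u i) (phi i) (u j) (u j) +
  2 * qint leb Omega (B i j) (u i) (u i) (u j) (phi j).

Definition dGB (h : 'I_m) u phi : R :=
  (\sum_(i | block a h i) 2 * energy_form Omega (V i) (u i) (phi i)) -
  \sum_(k < m) \sum_(i | block a h i) \sum_(j | block a k j) quartic_diff u phi i j.

Definition dJB u phi : R :=
  2^-1 * (\sum_(i < d) 2 * energy_form Omega (V i) (u i) (phi i)) -
  4^-1 * (\sum_(i < d) \sum_(j < d) quartic_diff u phi i j).

Lemma has_differential_GB h u phi : HH Omega u -> HH Omega phi ->
  has_differential (GB Omega a V B h) u phi (dGB h u phi).
Proof.
move=> Hu Hp; rewrite /has_differential.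
have D1 : is_derive (0 : R) (1 : R) (fun t => block_normsq Omega a V h
      (fun i x => u i x + t * phi i x))
    (\sum_(i | block a h i) 2 * energy_form Omega (V i) (u i) (phi i)).
  by apply: is_derive_bigsum => i; exact: is_derive_normsq.
have D2 : is_derive (0 : R) (1 : R) (fun t => \sum_(k < m)
      MB Omega a B (fun i x => u i x + t * phi i x) h k)
    (\sum_(k < m) \sum_(i | block a h i) \sum_(j | block a k j)
       quartic_diff u phi i j).
  apply: is_derive_bigsum => k; under eq_fun do rewrite mxE.
  apply: is_derive_bigsum => i; apply: is_derive_bigsum => j.
  by apply: is_derive_quartic => //; exact: f4.
exact: (is_deriveB D1 D2).
Qed.

Lemma has_differential_JB u phi : HH Omega u -> HH Omega phi ->
  has_differential (JB Omega V B) u phi (dJB u phi).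
Proof.
move=> Hu Hp; rewrite /has_differential /JB.
have D1 : is_derive (0 : R) (1 : R) (fun t => \sum_(i < d) normsq Omega (V i)
      (fun x => u i x + t * phi i x))
    (\sum_(i < d) 2 * energy_form Omega (V i) (u i) (phi i)).
  by apply: is_derive_bigsum => i; exact: is_derive_normsq.
have D2 : is_derive (0 : R) (1 : R) (fun t => \int[leb]_(x in Omega)
      (\sum_(i < d) \sum_(j < d)
         B i j x * (u i x + t * phi i x) ^+ 2 * (u j x + t * phi j x) ^+ 2))
    (\sum_(i < d) \sum_(j < d) quartic_diff u phi i j).
  (* [JB] integrates the double sum; to differentiate termwise, sum and integral are exchanged at
     every t, where L^4 integrability of u + t phi is used. *)
  rewrite (_ : (fun t => _) = fun t => \sum_(i < d) \sum_(j < d)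
      \int[leb]_(x in Omega)
        (B i j x * (u i x + t * phi i x) ^+ 2 * (u j x + t * phi j x) ^+ 2)).
    apply: is_derive_bigsum => i; apply: is_derive_bigsum => j.
    by apply: is_derive_quartic => //; exact: f4.
  apply/funext => t.
  have fl i : fourth_int leb Omega (fun x => u i x + t * phi i x).
    by apply: f4; exact: H01_lin.
  have ij i j : leb.-integrable Omega (EFin \o (fun x =>
      B i j x * (u i x + t * phi i x) ^+ 2 * (u j x + t * phi j x) ^+ 2)).
    have := ae_boundedM mO (bB i j) (quad_integrable mO (fl i) (fl i) (fl j) (fl j)).
    by apply: eq_integrable => // x _ /=; congr EFin; ring.
  rewrite Rintegral_sum//; first by apply: eq_bigr => i _; rewrite Rintegral_sum.
  move=> i; have := integrable_sum mO (index_enum 'I_d) (P := predT) (fun j _ => ij i j).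
  by apply: eq_integrable => // x _ /=; rewrite sumEFin.
exact: (is_deriveB (is_deriveZ 2^-1 D1) (is_deriveZ 4^-1 D2)).
Qed.

Let Q u (i j : 'I_d) : R := \int[leb]_(x in Omega) (B i j x * u i x ^+ 2 * u j x ^+ 2).

(** Putting u itself in a direction slot gives back [Q], so the slot of i contributes 2 s_i Q and
    that of j contributes 2 s_j Q. *)
Lemma quartic_diff_lin u phi (s : 'I_d -> R) i j : HH Omega u -> HH Omega phi ->
  quartic_diff u (fun i x => phi i x + s i * u i x) i j =
  quartic_diff u phi i j + 2 * (s i + s j) * Q u i j.
Proof.
move=> Hu Hp.
have QE : Q u i j = qint leb Omega (B i j) (u i) (u i) (u j) (u j).
  by apply: eq_Rintegral => x _; ring.
rewrite /quartic_diff QE qint_lin2 ?qint_lin4//; try exact: f4.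
by ring.
Qed.

Hypothesis Bsym : forall i j, ae_in Omega (fun x => B i j x = B j i x).

Let QC u i j : HH Omega u -> Q u i j = Q u j i.
Proof.
move=> Hu.
have mQ i' j' : measurable_fun Omega (fun x => B i' j' x * u i' x ^+ 2 * u j' x ^+ 2).
  have [mi _] := f4 (Hu i'); have [mj _] := f4 (Hu j'); have [mB _] := bB i' j'.
  by apply: measurable_funM; [apply: measurable_funM => //|]; exact: measurable_funX.
apply: ae_eq_Rintegral => //; have := Bsym i j; rewrite /ae_in.
by apply: filterS => x /[apply] ->; ring.
Qed.

Hypothesis da : is_decomposition d a.

(** The block of i. With it, the combination of the vectors (0, .., u_h, .., 0) with coefficients
    t_h has i-th component [t (bl i) * u i]. *)
Let bl (i : 'I_d) : 'I_m := xchoose (block_exists da i).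

Let blE i h : block a h i -> bl i = h.
Proof. exact: block_inj da _ _ _ (xchooseP (block_exists da i)). Qed.

(* Moving along the directions (0, .., u_h, .., 0) changes dGB by the matrix
   - 2 MB, and leaves dJB unchanged, since dJB(u)[u_h] = GB_h(u) = 0. *)
Lemma dGB_shift u phi (t : 'I_m -> R) h : HH Omega u -> HH Omega phi ->
  GB Omega a V B h u = 0 ->
  dGB h u (fun i x => phi i x + t (bl i) * u i x) =
  dGB h u phi - 2 * \sum_(k < m) MB Omega a B u h k * t k.
Proof.
move=> Hu Hp /eqP; rewrite subr_eq0 => /eqP G0.
have -> : \sum_(k < m) MB Omega a B u h k * t k =
    \sum_(k < m) \sum_(i | block a h i) \sum_(j | block a k j) t k * Q u i j.
  apply: eq_bigr => k _; rewrite mxE mulrC mulr_sumr; apply: eq_bigr => i _.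
  by rewrite mulr_sumr.
rewrite /dGB.
have -> : \sum_(i | block a h i)
      2 * energy_form Omega (V i) (u i) (fun x => phi i x + t (bl i) * u i x) =
    \sum_(i | block a h i) 2 * energy_form Omega (V i) (u i) (phi i) +
    2 * t h * block_normsq Omega a V h u.
  rewrite /block_normsq mulr_sumr -big_split/=; apply: eq_bigr => i hi.
  by rewrite energy_form_lin// normsqE (blE hi); ring.
have -> : \sum_(k < m) \sum_(i | block a h i) \sum_(j | block a k j)
      quartic_diff u (fun i x => phi i x + t (bl i) * u i x) i j =
    \sum_(k < m) \sum_(i | block a h i) \sum_(j | block a k j) quartic_diff u phi i j +
    (2 * t h * (\sum_(k < m) MB Omega a B u h k) +
     2 * \sum_(k < m) \sum_(i | block a h i) \sum_(j | block a k j) t k * Q u i j).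
  rewrite !mulr_sumr -!big_split/=; apply: eq_bigr => k _.
  rewrite mxE !mulr_sumr -!big_split/=; apply: eq_bigr => i hi.
  rewrite !mulr_sumr -!big_split/=; apply: eq_bigr => j kj.
  rewrite (quartic_diff_lin (fun i => t (bl i)))// (blE hi) (blE kj) -/(Q u i j).
  by ring.
(* G_h(u) = 0 cancels 2 t_h |u_h|^2 against 2 t_h sum_k M_hk; what remains is the term in M_hk
   t_k. *)
by rewrite G0; ring.
Qed.

(** By symmetry of [B] the variations in i and in j add up to 4 times one double sum, which the
    factor 1/4 compensates. The change is thus the sum over h of t_h G_h(u). *)
Lemma dJB_shift u phi (t : 'I_m -> R) : HH Omega u -> HH Omega phi ->
  (forall h, GB Omega a V B h u = 0) ->
  dJB u (fun i x => phi i x + t (bl i) * u i x) = dJB u phi.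
Proof.
move=> Hu Hp G0; rewrite /dJB.
have -> : \sum_(i < d)
      2 * energy_form Omega (V i) (u i) (fun x => phi i x + t (bl i) * u i x) =
    \sum_(i < d) 2 * energy_form Omega (V i) (u i) (phi i) +
    2 * \sum_(i < d) t (bl i) * normsq Omega (V i) (u i).
  rewrite mulr_sumr -big_split/=; apply: eq_bigr => i _.
  by rewrite energy_form_lin// normsqE; ring.
have -> : \sum_(i < d) \sum_(j < d)
      quartic_diff u (fun i x => phi i x + t (bl i) * u i x) i j =
    \sum_(i < d) \sum_(j < d) quartic_diff u phi i j +
    (2 * (\sum_(i < d) \sum_(j < d) t (bl i) * Q u i j) +
     2 * (\sum_(i < d) \sum_(j < d) t (bl j) * Q u i j)).
  rewrite !mulr_sumr -!big_split/=; apply: eq_bigr => i _.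
  rewrite !mulr_sumr -!big_split/=; apply: eq_bigr => j _.
  by rewrite (quartic_diff_lin (fun i => t (bl i)))//; ring.
have -> : \sum_(i < d) \sum_(j < d) t (bl j) * Q u i j =
    \sum_(i < d) \sum_(j < d) t (bl i) * Q u i j.
  rewrite exchange_big/=; apply: eq_bigr => i _; apply: eq_bigr => j _.
  by rewrite QC.
suff -> : \sum_(i < d) t (bl i) * normsq Omega (V i) (u i) =
    \sum_(i < d) \sum_(j < d) t (bl i) * Q u i j by field.
rewrite !(sum_block da); apply: eq_bigr => h _.
have /eqP := G0 h; rewrite subr_eq0 => /eqP Gh.
transitivity (t h * block_normsq Omega a V h u).
  by rewrite mulr_sumr; apply: eq_bigr => i hi; rewrite (blE hi).
rewrite Gh mulr_sumr.
under eq_bigr do rewrite mxE mulr_sumr.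
rewrite exchange_big/=; apply: eq_bigr => i hi; rewrite (sum_block da).
by apply: eq_bigr => k _; rewrite mulr_sumr; apply: eq_bigr => j _; rewrite (blE hi).
Qed.

Lemma constrained_critical_free u : constrained_critical_point Omega a V B u ->
  free_critical_point Omega V B u.
Proof.
move=> [[Hu sdd] [_ neh] crit]; split=> // phi Hp.
have G0 h : GB Omega a V B h u = 0 by case: (neh h).
(* The shift subtracts 2 M t from the differentials of the G_h, so M t is prescribed to be half of
   them: the corrected direction [psi] is tangent. *)
have [t Ht] := diagonally_dominant_solve (fun h => 2^-1 * dGB h u phi) sdd.
pose psi i x := phi i x + t (bl i) * u i x.
have Hpsi : HH Omega psi by move=> i; exact: H01_lin.
have dG0 h : has_differential (GB Omega a V B h) u psi 0.
  have := has_differential_GB h Hu Hpsi; rewrite /psi dGB_shift// Ht.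
  by rewrite mulrA divff// mul1r subrr.
have dJ0 : dJB u phi = 0.
  rewrite -(dJB_shift t Hu Hp G0).
  (* Two values of the same derivative along [psi], the explicit one and 0; they agree. *)
  have D1 := has_differential_JB Hu Hpsi; have D2 := crit _ Hpsi dG0.
  by rewrite -(@derive_val _ _ _ _ _ _ _ D1) (@derive_val _ _ _ _ _ _ _ D2).
by rewrite -dJ0; exact: has_differential_JB.
Qed.

(** A nonzero component is chosen in each block; the choice is injective since blocks are
    disjoint. *)
Lemma nehari_card_neq0 u : nehari Omega a V B u ->
  (m <= #|[pred i : 'I_d | `[< ~ ae_in Omega (fun x => u i x = 0%R) >]]|)%N.
Proof.
move=> [Hu neh].
have /choice[f fP] : forall h, exists i,
    block a h i /\ ~ ae_in Omega (fun x => u i x = 0).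
  move=> h; apply: contrapT => /forallNP H; case: (neh h) => /eqP + _; apply.
  apply: big1 => i hi; apply: normsq_ae0 => //; apply: contrapT => ui.
  exact: (H i).
have f_inj : injective f.
  move=> h k fhk; apply: (block_inj da (fP h).1); rewrite fhk; exact: (fP k).1.
rewrite -[leqLHS](card_ord m) -(card_codom f_inj); apply: subset_leq_card.
by apply/fintype.subsetP => i /codomP[h ->]; apply/asboolP; case: (fP h).
Qed.

End critical_points.

Theorem proposition1p2 (R : realType) (N d m : nat) (Omega : set 'rV[R]_N)
    (a : m.+1.-tuple nat) (V : 'I_d -> 'rV[R]_N -> R)
    (B : 'I_d -> 'I_d -> 'rV[R]_N -> R) (lam mu : 'I_d -> R)
    (u : 'I_d -> 'rV[R]_N -> R) :
  (0 < N <= 3)%N ->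
  regular_bounded_domain Omega ->
  (2 <= d)%N -> (m <= d)%N -> is_decomposition d a ->
  (forall i, Lp Omega +oo%E (V i)) ->
  (forall i j, Lp Omega +oo%E (B i j)) ->
  (forall i j, ae_in Omega (fun x => B i j x = B j i x)) ->
  (forall i, - lambda1 Omega < lam i) ->
  (forall i, ae_in Omega (fun x => lam i <= V i x)) ->
  (forall i, 0 < mu i) ->
  (forall i, ae_in Omega (fun x => mu i <= B i i x)) ->
  constrained_critical_point Omega a V B u ->
  free_critical_point Omega V B u /\
  (m <= #|[pred i : 'I_d | `[< ~ ae_in Omega (fun x => u i x = 0%R) >]]|)%N.
Proof.
move=> N3 [oO _ _ _ _] _ _ da LV LB Bsym _ _ _ _ cu.
have bV i := Lpoo_ae_bounded oO (LV i).
have bB i j := Lpoo_ae_bounded oO (LB i j).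
split; first exact: constrained_critical_free cu.
by case: cu => _ nu _; exact: nehari_card_neq0 nu.
Qed.
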